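(* Let $n\geq 3$ and let $C\in\mathbb{R}^{n\times n}$ be row-stochastic, irreducible, and with zero diagonal, with dominant left eigenvector $c^\top$. Given the same matrix $C$ and the same non-autocratic initial state $x(0)\in\Delta_n\setminus\{e_1,\dots,e_n\}$, the single-timescale DF dynamical system $x(t+1)=C^\top(x(t)-x(t)^2)+x(t)^2$ converges to the same equilibrium as the dynamical system $x(s+1)=w(x(s))$ of the (original) DF model. Consequently, the social power in the single-timescale DF dynamical system is accumulated to the individuals $i$ in the social network with high values $c_i$.
   Context: $\Delta_n=\{x\in\mathbb{R}^n : x_i\geq 0 \text{ for all } i,\ \sum_i x_i=1\}$ is the simplex and $e_1,\dots,e_n$ are the standard basis vectors of $\mathbb{R}^n$ (the autocratic states). For a vector $x$, $x^2=(x_1^2,\dots,x_n^2)^\top$ is the entrywise square. A matrix is row-stochastic if its entries are non-negative and each row sums to $1$. For $x\in\Delta_n$ let $W(x)=\operatorname{diag}(x)+(I_n-\operatorname{diag}(x))C$, where $C$ is the relative interaction matrix of a group of $n$ individuals and $x_i$ is the self-weight (equal to the social power) of individual $i$. The single-timescale DF (DeGroot-Friedkin) model is $x(t+1)=W(x(t))^\top x(t)=C^\top(x(t)-x(t)^2)+x(t)^2$, $t=0,1,2,\dots$. The original DF model is $x(s+1)=w(x(s))$, $s=0,1,2,\dots$, where for $x\in\Delta_n$ the row vector $w(x)^\top$ is the dominant left eigenvector of $W(x)$, i.e. the unique row vector with $w(x)^\top W(x)=w(x)^\top$ and $w(x)\in\Delta_n$. The dominant left eigenvector $c^\top$ of $C$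 is the unique row vector with $c^\top C=c^\top$ and $c\in\Delta_n$; its entries $c_i$ are the eigenvector centrality scores of the individuals. The phrase ''social power is accumulated to the individuals with high $c_i$ values'' is an informal, qualitative statement. *)

(* Defs.v *)
From mathcomp Require Import all_boot all_order all_algebra.
From mathcomp Require Import boolp classical_sets reals topology normedtype.
From mathcomp Require Import sequences.

Set Implicit Arguments.
Unset Strict Implicit.
Unset Printing Implicit Defensive.

Import Order.TTheory GRing.Theory Num.Theory.
Import numFieldNormedType.Exports.

Local Open Scope classical_set_scope.
Local Open Scope ring_scope.

Definition simplex (R : realType) (n : nat) : set 'cV[R]_n :=
  [set x | (forall i, 0 <= x i 0) /\ \sum_i x i 0 = 1].

Definition autocratic (R : realType) (n : nat) (i : 'I_n) : 'cV[R]_n :=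
  delta_mx i 0.

Definition sqv (R : realType) (n : nat) (x : 'cV[R]_n) : 'cV[R]_n :=
  \col_i (x i 0 ^+ 2).

Definition row_stochastic (R : realType) (n : nat) (M : 'M[R]_n) : Prop :=
  (forall i j, 0 <= M i j) /\ (forall i, \sum_j M i j = 1).

(* For a non-negative matrix: strong connectedness of its digraph, which has
   an arc from i to j exactly when M i j > 0. *)
Definition irreducible (R : realType) (n : nat) (M : 'M[R]_n) : Prop :=
  forall i j, connect [rel k l | 0 < M k l] i j.

Definition stationary (R : realType) (n : nat) (M : 'M[R]_n) : set 'cV[R]_n :=
  [set v | simplex v /\ v^T *m M = v^T].

Definition dominant_left (R : realType) (n : nat) (M : 'M[R]_n)
  (v : 'cV[R]_n) : Prop := unique (stationary M) v.

Definition influence (R : realType) (n : nat) (C : 'M[R]_n) (x : 'cV[R]_n) :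
  'M[R]_n := diag_mx x^T + (1%:M - diag_mx x^T) *m C.

Definition stdf_step (R : realType) (n : nat) (C : 'M[R]_n) (x : 'cV[R]_n) :
  'cV[R]_n := C^T *m (x - sqv x) + sqv x.

(* The default value 0 of xget is never used on the simplex when C is
   row-stochastic and irreducible: see df_stepP. *)
Definition df_step (R : realType) (n : nat) (C : 'M[R]_n) (x : 'cV[R]_n) :
  'cV[R]_n := xget 0 [set v | dominant_left (influence C x) v].

(* Accumulation of social power at the individuals of high centrality c.
   Either all the power goes to the individual with the strictly highest
   centrality, or x ranks the individuals exactly as c does and the
   amplification x_i / c_i of the centrality strictly increases with c_i.
   The first case does occur (star topologies); there the strict ranking of
   the others is lost, as all of them have power 0. *)
Definition favours_central (R : realType) (n : nat) (c x : 'cV[R]_n) :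
  Prop :=
  (exists k, x = autocratic R k /\ forall i, i != k -> c i 0 < c k 0) \/
  ((forall i j, (x i 0 <= x j 0) = (c i 0 <= c j 0)) /\
   (forall i j, c i 0 < c j 0 -> x i 0 / c i 0 < x j 0 / c j 0)).

Lemma row_mass (R : realType) (n : nat) (M : 'M[R]_n) (p : 'rV[R]_n) :
  row_stochastic M -> \sum_j (p *m M) 0 j = \sum_i p 0 i.
Proof.
move=> [_ M1]; under eq_bigr do rewrite mxE.
by rewrite exchange_big; apply: eq_bigr => i _; rewrite -mulr_sumr M1 mulr1.
Qed.

Lemma abs_fix (R : realType) (n : nat) (M : 'M[R]_n) (p : 'rV[R]_n) :
  row_stochastic M -> p *m M = p ->
  map_mx Num.norm p *m M = map_mx Num.norm p.
Proof.
move=> Mst pM; set q := map_mx _ p.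
have le_q j : q 0 j <= (q *m M) 0 j.
  rewrite mxE -[in leLHS]pM !mxE (le_trans (ler_norm_sum _ _ _))//.
  by apply: ler_sum => i _; rewrite normrM mxE (ger0_norm (Mst.1 _ _)).
have s0 : \sum_j ((q *m M) 0 j - q 0 j) = 0.
  by rewrite sumrB (row_mass _ Mst) subrr.
apply/rowP => j; apply/eqP; rewrite -subr_eq0; apply/eqP.
by apply: (psumr_eq0P _ s0) => // k _; rewrite subr_ge0.
Qed.

Lemma pos_connect (R : realType) (n : nat) (M : 'M[R]_n) (p : 'rV[R]_n)
    (i k : 'I_n) :
  row_stochastic M -> p *m M = p -> (forall j, 0 <= p 0 j) ->
  connect [rel a b | 0 < M a b] i k -> 0 < p 0 i -> 0 < p 0 k.
Proof.
move=> [M0 _] pM p0 /connectP[s]; elim: s i => [|j s IHs] i /=.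
  by move=> _ ->.
move=> /andP[Mij sP] ks pi; apply: (IHs _ sP ks).
rewrite -pM mxE (bigD1 i)//= ltr_wpDr ?mulr_gt0//.
by apply: sumr_ge0 => l _; rewrite mulr_ge0.
Qed.

Lemma dominant_left_exists (R : realType) (n : nat) (M : 'M[R]_n) (k : 'I_n) :
  row_stochastic M -> (forall i, connect [rel a b | 0 < M a b] i k) ->
  exists v, dominant_left M v.
Proof.
move=> Mst toK.
have pos_k (p : 'rV[R]_n) : p *m M = p -> (forall j, 0 <= p 0 j) ->
    p 0 k = 0 -> p = 0.
  move=> pM p0 pk; apply/rowP => i; rewrite mxE; apply/eqP.
  rewrite eq_le p0 andbT leNgt; apply/negP => pi.
  by have := pos_connect Mst pM p0 (toK i) pi; rewrite pk ltxx.
have [q qM q_neq0] : exists2 q : 'rV[R]_n, q *m M = q & q != 0.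
  have : \det (M - 1%:M)^T == 0.
    apply/det0P; exists (const_mx 1).
      by apply/eqP => /rowP/(_ k)/eqP; rewrite !mxE oner_eq0.
    rewrite -[const_mx _]trmxK -trmx_mul; apply/rowP => i; rewrite !mxE.
    under eq_bigr do rewrite !mxE mulr1.
    rewrite sumrB Mst.2 (bigD1 i)//= eqxx big1 ?addr0 ?subrr// => j.
    by rewrite eq_sym => /negbTE->.
  rewrite det_tr => /det0P[q q0 /eqP].
  by rewrite mulmxBr mulmx1 subr_eq0 => /eqP ?; exists q.
pose a := map_mx Num.norm q.
have aM : a *m M = a by exact: abs_fix.
have a0 j : 0 <= a 0 j by rewrite mxE.
pose s := \sum_j a 0 j.
have s_gt0 : 0 < s.
  rewrite lt_neqAle sumr_ge0 ?andbT//; apply: contra q_neq0 => /eqP s0.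
  apply/eqP/rowP => j; apply/eqP; rewrite [eqbRHS]mxE -normr_eq0.
  have : a 0 j = 0 by apply: (psumr_eq0P _ (esym s0)).
  by rewrite /a mxE => ->.
have sum0 (d : 'rV[R]_n) :
    d *m M = d -> \sum_i d 0 i = 0 -> 0 <= d 0 k -> d = 0.
  move=> dM d_sum dk; pose d' := map_mx Num.norm d - d.
  have /pos_k d'0 : d' *m M = d' by rewrite mulmxBl (abs_fix Mst dM) dM.
  have {}d'0 : d' = 0.
    by apply: d'0 => [j|]; rewrite !mxE ?subr_ge0 ?ler_norm// ger0_norm ?subrr.
  have d0 i : 0 <= d 0 i.
    by move/rowP/(_ i): d'0; rewrite !mxE => /subr0_eq <-.
  by apply/rowP => i; rewrite mxE (psumr_eq0P (fun i _ => d0 i) d_sum).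
have st : stationary M (s^-1 *: a)^T.
  split; last by rewrite trmxK -scalemxAl aM.
  split=> [i|]; first by rewrite 2!mxE mulr_ge0 ?a0 ?invr_ge0 ?(ltW s_gt0).
  under eq_bigr do rewrite mxE mxE.
  by rewrite -mulr_sumr mulVf ?(gt_eqF s_gt0).
exists (s^-1 *: a)^T; split=> //; move: st.
move: (s^-1 *: a)^T => v [[v0 v1] vM] u [[u0 u1] uM].
have dM : (v - u)^T *m M = (v - u)^T.
  by rewrite (raddfB (@trmx R n 1)) mulmxBl vM uM.
have d_sum : \sum_i (v - u)^T 0 i = 0.
  under eq_bigr do rewrite !mxE.
  by rewrite sumrB v1 u1 subrr.
apply/subr0_eq/trmx_inj; rewrite trmx0.
have [dk|/ltW dk] := leP 0 ((v - u)^T 0 k); first exact: sum0.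
apply/oppr_inj; rewrite oppr0; apply: sum0; first by rewrite mulNmx dM.
- by under eq_bigr do rewrite mxE; rewrite sumrN d_sum oppr0.
- by rewrite mxE oppr_ge0.
Qed.

Lemma influenceE (R : realType) (n : nat) (C : 'M[R]_n) (x : 'cV[R]_n)
    (i j : 'I_n) :
  influence C x i j = x i 0 *+ (i == j) + (1 - x i 0) * C i j.
Proof.
by rewrite /influence mulmxBl mul1mx mul_diag_mx !mxE mulrBl mul1r.
Qed.

Lemma simplex_le1 (R : realType) (n : nat) (x : 'cV[R]_n) (i : 'I_n) :
  simplex x -> x i 0 <= 1.
Proof. by move=> [x0 <-]; rewrite (bigD1 i)//= lerDl sumr_ge0. Qed.

Lemma influence_stochastic (R : realType) (n : nat) (C : 'M[R]_n)
    (x : 'cV[R]_n) :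
  row_stochastic C -> simplex x -> row_stochastic (influence C x).
Proof.
move=> [C0 C1] xD; split=> i => [j|].
  rewrite influenceE addr_ge0 ?mulrn_wge0 ?mulr_ge0 ?(xD.1 i)//.
  by rewrite subr_ge0 simplex_le1.
under eq_bigr do rewrite influenceE.
rewrite big_split /= -mulr_sumr C1 mulr1 (bigD1 i)//= eqxx big1 => [|j].
  by rewrite addr0 mulr1n addrC subrK.
by rewrite eq_sym => /negbTE->.
Qed.

Lemma df_stepP (R : realType) (n : nat) (C : 'M[R]_n) (x : 'cV[R]_n) :
  row_stochastic C -> irreducible C -> simplex x ->
  dominant_left (influence C x) (df_step C x).
Proof.
move=> Cst Cirr xD; rewrite /df_step; apply: xgetPex.
have [k xk] : exists k, forall i, i != k -> x i 0 < 1.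
  have [/existsP[k /eqP xk]|] := boolP [exists k, x k 0 == 1].
    exists k => i ik; rewrite -xD.2 (bigD1 k)//= xk (bigD1 i)//= addrCA ltrDl.
    by rewrite ltr_wpDr ?ltr01// sumr_ge0// => j _; exact: xD.1.
  rewrite negb_exists => /forallP x1.
  case: (pickP (@predT 'I_n)) => [k _|n0]; last first.
    by have := xD.2; rewrite big_pred0 // => /eqP; rewrite eq_sym oner_eq0.
  by exists k => i _; rewrite lt_neqAle x1 simplex_le1.
apply: (@dominant_left_exists _ _ _ k); first exact: influence_stochastic.
move=> i; case/connectP: (Cirr i k) => s.
elim: s i => [|j s IHs] i /=; first by move=> _ ->.
move=> /andP[Cij sP] ks; have [->//|ik] := eqVneq i k.
apply: connect_trans (IHs j sP ks); apply: connect1 => /=.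
rewrite influenceE ltr_wpDl ?mulrn_wge0 ?(xD.1 i)//.
by rewrite mulr_gt0// subr_gt0 xk.
Qed.

(* Main.v *)
Require Import Defs.
From mathcomp Require Import all_boot all_order all_algebra.
From mathcomp Require Import boolp classical_sets reals topology normedtype.
From mathcomp Require Import sequences derive realfun.
From mathcomp Require Import ring lra.

Set Implicit Arguments.
Unset Strict Implicit.
Unset Printing Implicit Defensive.

Import Order.TTheory GRing.Theory Num.Theory.
Import numFieldNormedType.Exports.

Local Open Scope classical_set_scope.
Local Open Scope ring_scope.

(** Write h(y) = y (1 - y).  One step of the single-timescale system adds
    (C^T - 1) h(x) to x, and one step of the DF system sends u to the state w
    for which (1 - u_i) w_i is proportional to c_i ([df_step_rel]).  Hence a
    state b with h(b_i) = mu c_i for all i is an equilibrium of both, and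
    [equilibrium_exists] finds one by the intermediate value theorem.  Only an
    individual k of maximal centrality, the hub, may have b_k > 1/2.  When
    c_k = 1/2, which is the case of star topologies, b is the autocratic state
    of k and mu = 0.

    Convergence is proved on the set L of limit points of an orbit, which is
    compact and in which every point has a predecessor.  It comes from a barrier
    and a Lyapunov function.

    The barrier.  For m <= mu let p_i <= 1/2 be the solution of h(p_i) = m c_i.
    Then p_i is at most the sum of the other p_j ([profile_gap]), so that a state
    x >= p satisfies x_i <= 1 - p_i too, whence h(x_i) >= m c_i
    ([level_set_hump]).  This makes the set of the states above p invariant for
    both systems.  After finitely many steps all weights are positive, so some
    profile of positive level lies below L if mu > 0.  Let m be the largest level
    whose profile lies below L.  If m < mu, a contact of L with p spreads
    backwards in time along the arcs of C until some point of L is p itself; but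
    the entries of p sum to less than 1.  So m = mu ([limit_in_level_set]).  If b_k <= 1/2, the profile of level mu is
    b, and L = {b}.

    The Lyapunov function.  If b_k > 1/2, the states above the profile of level
    mu have x_j >= b_j for j != k and 1 - b_k <= x_k <= b_k.  There the DF system
    does not decrease x_k ([df_hub]).  For the single-timescale system take a
    linear function v . x, where (1 - C) v = g, g_k = -1, g_j > 0 for j != k, and
    g is orthogonal to c: it drops by the sum of the g_i h(x_i) at each step, and
    a suitable choice of g makes this sum nonnegative, and zero only at b
    ([dissipation]).  For star topologies -x_k serves for both systems, but for
    the single-timescale one it is strict only over two steps
    ([stdf_lyapunov_star]).  In all cases L = {b} by [lyapunov_collapse]. *)

(** * Continuity and closed sets *)

Lemma continuous_sumR (R : realType) (T : topologicalType) (I : Type)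
    (r : seq I) (P : pred I) (f : I -> T -> R) :
  (forall i, continuous (f i)) ->
  continuous (fun x => \sum_(i <- r | P i) f i x).
Proof.
move=> fc; apply: continuous_big => [|i _]; last exact: fc.
exact: add_continuous.
Qed.

Section Continuity.
Context {R : realType} {T : topologicalType}.
Implicit Types f g : T -> R.

Lemma continuous_mulR f g :
  continuous f -> continuous g -> continuous (fun x => f x * g x).
Proof. by move=> fc gc x; apply: cvgM; [exact: fc|exact: gc]. Qed.

Lemma continuous_subR f g :
  continuous f -> continuous g -> continuous (fun x => f x - g x).
Proof. by move=> fc gc x; apply: cvgB; [exact: fc|exact: gc]. Qed.

Lemma continuous_cstR (a : R) : continuous (fun _ : T => a).
Proof. by move=> x; exact: cvg_cst. Qed.

End Continuity.

Lemma closed_zeros (R : realType) (T : topologicalType) (I : Type)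
    (g : I -> T -> R) :
  (forall i, continuous (g i)) -> closed [set p | forall i, g i p = 0].
Proof.
move=> gc.
rewrite (_ : mkset _ = \bigcap_(i in setT) (g i @^-1` [set x | x = 0])).
  apply: closed_bigI => i _.
  by apply: preimage_closed => [x _|]; [exact: gc|exact: closed_eq].
by apply/seteqP; split=> p /= h => [i _|i]; exact: h.
Qed.

(** * Limit points of an orbit *)

Lemma ultra_fmap (S T : Type) (f : S -> T) (F : set_system S) :
  UltraFilter F -> UltraFilter (f @ F).
Proof.
move=> FU; split=> [|G GF FG]; first exact: fmap_proper_filter.
apply/seteqP; split=> // A GA; have [//|FnA] := in_ultra_setVsetC (f @^-1` A) FU.
have GnA : G (A `&` ~` A) by apply: filterI => //; exact: FG.
by have [y [Ay nAy]] := filter_ex GnA; case: (nAy Ay).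
Qed.

Section LimitSet.
Context {R : realType} {n : nat}.
Notation V := ('cV[R]_n).
Implicit Types (x : nat -> V) (z b : V).

Lemma cvg_coord {T : Type} (F : set_system T) (f : T -> V) z :
  Filter F -> (forall i, f t i 0 @[t --> F] --> z i 0) -> f @ F --> z.
Proof.
move=> FF fz N [P zP PN].
have : \forall t \near F, forall i, P i 0 (f t i 0).
  by apply: filter_forall => i; apply: fz; apply: zP.
by apply: filterS => t Pt; apply: PN => i j; rewrite (ord1 j).
Qed.

(** Column vectors carry the product topology: along an ultrafilter each
    coordinate converges in [0, 1], and the coordinatewise limit is a limit. *)
Lemma compact_box : compact [set z : V | forall i, 0 <= z i 0 <= 1].
Proof.
rewrite compact_ultra => F FU FB.
have lim_i i : exists p : R, (0 <= p <= 1) /\ z i 0 @[z --> F] --> p.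
  have := @segment_compact R 0 1; rewrite compact_ultra.
  move=> /(_ ((fun z : V => z i 0) @ F)) [||p [p01 Fp]].
  - exact: (ultra_fmap _ FU).
  - apply: (@filterS _ F _ _ _ _ FB) => z zB; rewrite /= in_itv; exact: zB.
  - by exists p; split=> //; move: p01; rewrite /= in_itv.
pose p := \col_i projT1 (cid (lim_i i)).
have pP i : (0 <= p i 0 <= 1) /\ z i 0 @[z --> F] --> p i 0.
  by rewrite mxE; exact: projT2 (cid (lim_i i)).
exists p; split; first by move=> i; exact: (pP i).1.
by apply: (@cvg_coord _ F id) => i; exact: (pP i).2.
Qed.

Lemma continuous_coord i : continuous (fun z : V => z i 0).
Proof. exact: coord_continuous. Qed.

Definition limit_set x : set V := cluster (x @ \oo).

Lemma limit_set_sub x (A : set V) :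
  closed A -> (\forall t \near \oo, A (x t)) -> limit_set x `<=` A.
Proof.
move=> clA xA z; rewrite /limit_set clusterE => /(_ A xA).
by rewrite -(closure_id A).1.
Qed.

Lemma limit_set_compact x :
  (forall t i, 0 <= x t i 0 <= 1) -> compact (limit_set x).
Proof.
move=> x01.
have clL : closed (limit_set x).
  by rewrite /limit_set clusterE; apply: closed_bigI => A _; exact: closed_closure.
apply: (subclosed_compact clL compact_box); apply: limit_set_sub; last exact: nearW.
rewrite (_ : mkset _ = \bigcap_(i in setT) [set z : V | 0 <= z i 0 <= 1]).
  apply: closed_bigI => i _.
  rewrite (_ : mkset _ = (fun z : V => z i 0) @^-1` `[0, 1]%classic).
    by apply: preimage_closed => [y _|]; [exact: continuous_coord | exact: itv_closed].
  by apply/seteqP; split=> z /=; rewrite in_itv.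
by apply/seteqP; split=> z /= => [zi i _|zi i]; exact: zi.
Qed.

(** The filter generated by the tails of nat and the preimages of the
    neighbourhoods of z is proper, since z is a limit point. *)
Lemma limit_set_ultra x z : limit_set x z ->
  exists U : set_system nat, [/\ UltraFilter U, \oo `<=` U & x @ U --> z].
Proof.
move=> xz.
pose F : set_system nat := filter_from [set p : nat * set V | nbhs z p.2]
  (fun p => [set t | (p.1 <= t)%N /\ p.2 (x t)]).
have FF : ProperFilter F.
  apply: filter_from_proper; first apply: filter_from_filter.
  - by exists (0%N, setT); exact: filterT.
  - move=> [s A] [t B] zA zB; exists (maxn s t, A `&` B); first exact: filterI.
    by move=> r [/=]; rewrite geq_max => /andP[? ?] [? ?].
  - move=> [s A] zA.
    have [||_ [[t st <-] Ax]] := xz [set x t | t in [set t | (s <= t)%N]] A.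
    + by exists s => // t /= st; exists t.
    + by [].
    + by exists t.
have [U [UU FU]] := ultraFilterLemma FF.
exists U; split=> //.
- by move=> A [s _ sA]; apply: FU; exists (s, setT); [exact: filterT|move=> t [/= /sA]].
- by move=> A zA; apply: FU; exists (0%N, A) => // t [].
Qed.

Lemma ultra_limit_set x (U : set_system nat) z :
  UltraFilter U -> \oo `<=` U -> x @ U --> z -> limit_set x z.
Proof.
move=> UU ooU xz A B xA zB.
have : U (x @^-1` (A `&` B)).
  by apply: (@filterI _ U _ (x @^-1` A) (x @^-1` B)); [exact: ooU|exact: xz].
by move=> /filter_ex[t ABt]; exists (x t).
Qed.

(** Dynamics are relations rather than maps, because the DF step is only
    characterized implicitly; a closed graph replaces continuity. *)
Definition closed_rel (G : V -> V -> Prop) := closed [set p : V * V | G p.1 p.2].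

(** If the orbit tends to z along an ultrafilter U, then along the image of U by
    the predecessor map it tends to some y by compactness, and (y, z) is a limit of
    pairs of consecutive states. *)
Lemma limit_set_pred x (G : V -> V -> Prop) z :
  (forall t i, 0 <= x t i 0 <= 1) -> closed_rel G ->
  (forall t, G (x t) (x t.+1)) -> limit_set x z ->
  exists2 y, limit_set x y & G y z.
Proof.
move=> x01 clG G_orbit /limit_set_ultra[U [UU ooU xz]].
have oo_pred : \oo `<=` (predn @ U).
  move=> A [s _ sA]; apply: ooU; exists s.+1 => // -[//|t] st; exact: sA.
have /= := compact_box; rewrite compact_ultra => /(_ ((x \o predn) @ U)) [||y [_ xy]].
- exact: ultra_fmap.
- by apply: (@filterE _ U) => t i; exact: x01.
exists y.
  by apply: (@ultra_limit_set x (predn @ U)) => //; exact: ultra_fmap.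
have : (x t.-1, x t) @[t --> U] --> (y, z).
  by apply: (@cvg_pair _ _ _ U (nbhs y) (nbhs z) _ _ _ (x \o predn) x).
apply: (closed_cvg _ clG).
by apply: ooU; exists 1%N => // -[//|t] _; exact: G_orbit.
Qed.

(** Were the orbit not to converge to b, an ultrafilter avoiding a neighbourhood
    of b would produce another limit point. *)
Lemma limit_set_cvg x b :
  (forall t i, 0 <= x t i 0 <= 1) -> limit_set x `<=` [set b] -> x @ \oo --> b.
Proof.
move=> x01 Lb N bN; apply: contrapT => nN.
pose F := within [set t | ~ N (x t)] \oo.
have FF : ProperFilter F.
  apply: Build_ProperFilter_ex => A; rewrite /F/= => FA.
  apply: contrapT => nA; apply: nN.
  apply: (@filterS nat \oo _ [set t | ~ N (x t) -> A t] (x @^-1` N) _ FA) => t tA.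
  by apply: contrapT => nt; apply: nA; exists t; exact: tA.
have [U [UU FU]] := ultraFilterLemma FF.
have ooU : \oo `<=` U.
  by move=> A ooA; apply: FU; apply: (@filterS nat \oo _ A _ _ ooA) => t At _.
have /= := compact_box; rewrite compact_ultra => /(_ (x @ U)) [||y [_ xy]].
- exact: ultra_fmap.
- by apply: (@filterE _ U) => t i; exact: x01.
have yb : y = b by apply: Lb; exact: ultra_limit_set xy.
have : U [set t | ~ N (x t)] by apply: FU; apply: (@filterE nat \oo) => t; exact.
rewrite yb in xy => UnN.
have : U ((x @^-1` N) `&` [set t | ~ N (x t)]) by apply: filterI; [exact: xy|].
by move=> /filter_ex[t [Nt nNt]]; exact: (nNt Nt).
Qed.

Lemma limit_set_nonempty x :
  (forall t i, 0 <= x t i 0 <= 1) -> limit_set x !=set0.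
Proof.
move=> x01; have [|z [_ xz]] := compact_box (F := x @ \oo); last by exists z.
by apply: (@filterE nat \oo) => t i; exact: x01.
Qed.

(** At a maximum z of W on L, two successive predecessors of z in L also have
    maximal W, so that strictness over two steps is enough: the nearer predecessor
    is b, and b minimizes W. *)
Lemma lyapunov_collapse (L : set V) (G : V -> V -> Prop) (W : V -> R) b :
  compact L -> (forall z, L z -> exists2 y, L y & G y z) -> continuous W ->
  (forall z, L z -> z <> b -> W b < W z) ->
  (forall y z, L y -> L z -> G y z -> W z <= W y) ->
  (forall w y z, L w -> L y -> G w y -> G y z -> W y = W w -> W z = W y ->
    y = b) ->
  L `<=` [set b].
Proof.
move=> cL Lpred cW Wb Wmono Wstrict z Lz; apply: contrapT => zb.
have [m /set_mem Lm mmax] : exists2 m, m \in L & forall t, t \in L -> W t <= W m.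
  apply: compact_EVT_max => //; first by exists z.
  exact: continuous_subspaceT.
have Wbm : W b < W m by apply: lt_le_trans (Wb _ Lz zb) (mmax _ (mem_set Lz)).
have [y Ly Gym] := Lpred _ Lm; have [w Lw Gwy] := Lpred _ Ly.
have Wym : W y = W m.
  by apply/eqP; rewrite eq_le mmax ?mem_set//= Wmono.
have Wwy : W w = W y.
  by apply/eqP; rewrite eq_le (Wmono w y)// andbT Wym mmax ?mem_set.
have yb : y = b by apply: (Wstrict w y m).
by move: Wbm; rewrite -Wym yb ltxx.
Qed.

End LimitSet.

Lemma continuous_fst_coord (R : realType) (n : nat) (i : 'I_n) :
  continuous (fun p : 'cV[R]_n * 'cV[R]_n => p.1 i 0).
Proof.
move=> p; apply: (@cvg_comp _ _ _ fst (fun z : 'cV[R]_n => z i 0) _ (nbhs p.1)).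
  exact: cvg_fst.
exact: continuous_coord.
Qed.

Lemma continuous_snd_coord (R : realType) (n : nat) (i : 'I_n) :
  continuous (fun p : 'cV[R]_n * 'cV[R]_n => p.2 i 0).
Proof.
move=> p; apply: (@cvg_comp _ _ _ snd (fun z : 'cV[R]_n => z i 0) _ (nbhs p.2)).
  exact: cvg_snd.
exact: continuous_coord.
Qed.

(** * Finite sums and the simplex *)

Lemma third_index (n : nat) (i j : 'I_n) :
  (3 <= n)%N -> exists2 l : 'I_n, l != i & l != j.
Proof.
move=> n3; have : (0 < #|~: [set i; j]|)%N.
  by rewrite cardsCs finset.setCK card_ord subn_gt0 (leq_ltn_trans _ n3)// cards2; case: eqP.
by case/card_gt0P => l; rewrite !inE negb_or => /andP[li lj]; exists l.
Qed.

Lemma sum_others (R : realType) (n : nat) (f : 'I_n -> R) k (s : R) :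
  \sum_i f i = s -> \sum_(i | i != k) f i = s - f k.
Proof. by move=> <-; rewrite [in RHS](bigD1 k)//= addrAC subrr add0r. Qed.

Lemma sum_lt (R : realType) (n : nat) (P : pred 'I_n) (f g : 'I_n -> R) j :
  P j -> (forall i, P i -> f i < g i) -> \sum_(i | P i) f i < \sum_(i | P i) g i.
Proof.
move=> Pj fg; rewrite (bigD1 j)//= [ltRHS](bigD1 j)//=.
by rewrite ltr_leD ?fg// ler_sum// => i /andP[/fg/ltW].
Qed.

Lemma autocraticE (R : realType) (n : nat) (i j : 'I_n) :
  autocratic R i j 0 = (j == i)%:R.
Proof. by rewrite mxE eqxx andbT. Qed.

Lemma simplex_autocratic (R : realType) (n : nat) (i : 'I_n) :
  simplex (autocratic R i).
Proof.
split=> [j|]; first by rewrite autocraticE ler0n.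
rewrite (bigD1 i)//= autocraticE eqxx big1 ?addr0// => j ji.
by rewrite autocraticE (negbTE ji).
Qed.

(** Two states of equal total mass cannot be strictly ordered. *)
Lemma simplex_le_eq (R : realType) (n : nat) (x y : 'cV[R]_n) :
  simplex x -> simplex y -> (forall i, x i 0 <= y i 0) -> y = x.
Proof.
move=> [_ x1] [_ y1] xy; apply/colP => i; apply/eqP; rewrite -subr_eq0; apply/eqP.
apply: (@psumr_eq0P _ _ xpredT (fun i => y i 0 - x i 0)) => //.
  by move=> j _; rewrite subr_ge0.
by rewrite sumrB x1 y1 subrr.
Qed.

Lemma simplex_sum3_le1 (R : realType) (n : nat) (x : 'cV[R]_n) (i j l : 'I_n) :
  simplex x -> j != i -> l != i -> l != j ->
  x i 0 + x j 0 + x l 0 <= 1.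
Proof.
move=> [x0 <-] ji li lj; rewrite (bigD1 i)//= (bigD1 j)//= (bigD1 l) ?li//=.
by rewrite !addrA lerDl sumr_ge0.
Qed.

Lemma simplex_eq_autocratic (R : realType) (n : nat) (x : 'cV[R]_n) (i : 'I_n) :
  simplex x -> x i 0 = 1 -> x = autocratic R i.
Proof.
move=> xD xi; apply: simplex_le_eq => //; first exact: simplex_autocratic.
move=> j; rewrite autocraticE; have [->|_] := eqVneq j i; first by rewrite xi.
exact: xD.1.
Qed.

Lemma closed_lower_bound (R : realType) (n : nat) (a : 'I_n -> R) :
  closed [set z : 'cV[R]_n | forall i, a i <= z i 0].
Proof.
rewrite (_ : mkset _ = \bigcap_(i in setT)
    ((fun z : 'cV[R]_n => z i 0) @^-1` [set x | a i <= x])).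
  by apply: closed_bigI => i _; apply: preimage_closed => [x _|];
    [exact: continuous_coord|exact: closed_ge].
by apply/seteqP; split=> p /= h => [i _|i]; exact: h.
Qed.

Lemma closed_simplex (R : realType) (n : nat) :
  closed [set z : 'cV[R]_n | simplex z].
Proof.
apply: closedI; first exact: closed_lower_bound (fun=> 0).
apply: (@preimage_closed _ _ (fun z : 'cV[R]_n => \sum_i z i 0)
  [set x | x = 1]) => [z _|]; last exact: closed_eq.
by apply: continuous_sumR => i; exact: continuous_coord.
Qed.

(** * Stationary vectors of an irreducible stochastic matrix *)

Section Perron.
Context {R : realType} {n : nat}.
Variables (C : 'M[R]_n) (c : 'cV[R]_n).
Hypotheses (C_stoch : row_stochastic C) (C_irr : irreducible C).
Hypothesis (c_dom : dominant_left C c).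

Lemma centrality_sum1 : \sum_i c i 0 = 1.
Proof. by have [[[_ ->]]] := c_dom. Qed.

Lemma centrality_fix i : \sum_j C j i * c j 0 = c i 0.
Proof.
have [[_ /rowP/(_ i) +] _] := c_dom; rewrite !mxE => <-.
by apply: eq_bigr => j _; rewrite mxE mulrC.
Qed.

Lemma centrality_gt0 i : 0 < c i 0.
Proof.
have [[[c0 c1] cC] _] := c_dom.
have /existsP[j cj] : [exists j, 0 < c j 0].
  apply: contrapT => /negP; rewrite negb_exists => /forallP cle.
  have := c1; rewrite big1 => [/eqP|j _]; first by rewrite eq_sym oner_eq0.
  by apply/eqP; rewrite eq_le c0 andbT leNgt cle.
have := @pos_connect R n C c^T j i C_stoch cC _ (C_irr j i); rewrite !mxE.
by apply=> // k; rewrite mxE.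
Qed.

(** After normalization, a nonnegative invariant vector is the stationary
    distribution. *)
Lemma nonneg_invariant (p : 'rV[R]_n) :
  (forall i, 0 <= p 0 i) -> p *m C = p -> p = (\sum_i p 0 i) *: c^T.
Proof.
move=> p0 pC; have [s0|s_neq0] := eqVneq (\sum_i p 0 i) 0.
  by rewrite s0 scale0r; apply/rowP => i; rewrite mxE (psumr_eq0P _ s0).
have s_gt0 : 0 < \sum_i p 0 i by rewrite lt_neqAle eq_sym s_neq0 sumr_ge0.
set s := \sum_i _ in s_gt0 s_neq0 *.
have -> : c = s^-1 *: p^T.
  apply: c_dom.2; split; last by rewrite linearZ /= trmxK -scalemxAl pC.
  split=> [i|]; first by rewrite !mxE mulr_ge0// invr_ge0 ltW.
  by under eq_bigr do rewrite !mxE; rewrite -mulr_sumr mulVf.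
by rewrite linearZ /= trmxK scalerA divff// scale1r.
Qed.

(** The entrywise absolute value |p| of an invariant p is invariant
    ([abs_fix]); p is the difference of the nonnegative invariant vectors |p| + p
    and |p|. *)
Lemma invariant_unique (p : 'rV[R]_n) :
  p *m C = p -> p = (\sum_i p 0 i) *: c^T.
Proof.
move=> pC; have aC := abs_fix C_stoch pC; set a := map_mx _ p in aC.
have [s ->] : exists s, p = s *: c^T.
  have a_c : a = (\sum_i a 0 i) *: c^T.
    by apply: nonneg_invariant aC => i; rewrite mxE.
  have ap_c : a + p = (\sum_i (a + p) 0 i) *: c^T.
    apply: nonneg_invariant; last by rewrite mulmxDl aC pC.
    by move=> i; rewrite !mxE -lerBlDr sub0r -normrN ler_norm.
  exists (\sum_i (a + p) 0 i - \sum_i a 0 i).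
  by rewrite scalerBl -ap_c -a_c addrC addKr.
congr (_ *: _); under eq_bigr do rewrite !mxE.
by rewrite -mulr_sumr centrality_sum1 mulr1.
Qed.

(** The columns of the cokernel of (1 - C)^T are invariant vectors of C, hence
    multiples of c; so the vectors orthogonal to c form the range of 1 - C. *)
Lemma fredholm (g : 'I_n -> R) :
  \sum_i g i * c i 0 = 0 ->
  exists v : 'I_n -> R, forall i, v i - \sum_j C i j * v j = g i.
Proof.
move=> gc; pose A := (1%:M - C)^T; pose h := \row_i g i.
have /submxP[D hD] : (h <= A)%MS.
  rewrite submxE; apply/eqP/rowP => l; rewrite !mxE.
  pose p := (col l (cokermx A))^T.
  have pC : p *m C = p.
    apply/eqP; rewrite eq_sym -subr_eq0 -{1}[p]mulmx1 -mulmxBr.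
    by rewrite -[1%:M - C]trmxK -/A -trmx_mul colE mulmxA mulmx_coker mul0mx trmx0.
  have coker_c i : cokermx A i l = (\sum_j p 0 j) * c i 0.
    have /rowP/(_ i) := invariant_unique pC.
    by rewrite [LHS]mxE [LHS]mxE => ->; rewrite 2!mxE.
  under eq_bigr do rewrite mxE coker_c mulrCA.
  by rewrite -mulr_sumr gc mulr0.
exists (D 0) => i; have /rowP/(_ i) := hD; rewrite !mxE => ->.
transitivity (\sum_j (D 0 j *+ (i == j) - C i j * D 0 j)).
  rewrite sumrB; congr (_ - _); rewrite (bigD1 i)//= eqxx mulr1n big1 ?addr0// => j.
  by rewrite eq_sym => /negbTE->.
by apply: eq_bigr => j _; rewrite !mxE mulrBr mulr_natr [C i j * _]mulrC.
Qed.

Hypothesis C_diag : forall i, C i i = 0.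

(** With a zero diagonal, the mass at i all comes from the other
    individuals. *)
Lemma centrality_le_half i : c i 0 <= 1 / 2.
Proof.
suff: c i 0 <= 1 - c i 0 by lra.
rewrite -centrality_sum1 [leRHS](_ : _ = \sum_(j | j != i) c j 0); last first.
  by rewrite (bigD1 i)//= addrAC subrr add0r.
rewrite -[leLHS]centrality_fix (bigD1 i)//= C_diag mul0r add0r.
apply: ler_sum => j _; rewrite ler_piMl ?(ltW (centrality_gt0 _))//.
by rewrite -(C_stoch.2 j) (bigD1 i)//= lerDl sumr_ge0// => l _; exact: C_stoch.1.
Qed.

(** If c_k = 1/2, the others carry 1/2 in total and send 1/2 to k, so each of
    them sends everything to k. *)
Lemma star_to_hub k j : c k 0 = 1 / 2 -> j != k -> C j k = 1.
Proof.
move=> ck jk.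
have C_le1 l : C l k <= 1.
  rewrite -(C_stoch.2 l) (bigD1 k)//= lerDl sumr_ge0// => i _; exact: C_stoch.1.
have s0 : \sum_(l | l != k) (1 - C l k) * c l 0 = 0.
  under eq_bigr do rewrite mulrBl mul1r.
  rewrite sumrB.
  have := centrality_fix k; rewrite (bigD1 k)//= C_diag mul0r add0r => ->.
  have := centrality_sum1; rewrite (bigD1 k)//= ck => h.
  by apply/eqP; rewrite subr_eq0; apply/eqP; lra.
have term_ge0 l : l != k -> 0 <= (1 - C l k) * c l 0.
  by rewrite mulr_ge0 ?subr_ge0 ?(ltW (centrality_gt0 _)).
have /eqP := psumr_eq0P term_ge0 s0 jk.
by rewrite mulf_eq0 (gt_eqF (centrality_gt0 j)) orbF subr_eq0 => /eqP.
Qed.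

(** As the others point only to k, the centrality of j comes from k
    alone. *)
Lemma star_from_hub_gt0 k j : c k 0 = 1 / 2 -> j != k -> 0 < C k j.
Proof.
move=> ck jk; rewrite lt_neqAle eq_sym C_stoch.1 andbT; apply/eqP => Ckj.
have := centrality_fix j; rewrite big1 => [/esym/eqP|l _].
  by rewrite (gt_eqF (centrality_gt0 j)).
have [->|lk] := eqVneq l k; first by rewrite Ckj mul0r.
suff -> : C l j = 0 by rewrite mul0r.
have := C_stoch.2 l; rewrite (bigD1 k)//= star_to_hub// => /eqP.
rewrite -subr_eq0 addrAC subrr add0r => /eqP s0.
by apply: (psumr_eq0P _ s0) => // i _; exact: C_stoch.1.
Qed.

End Perron.

(** * The small solution of y (1 - y) = s *)

Section Kappa.
Context {R : realType}.
Implicit Types s t x y : R.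

Definition kappa s : R := (1 - Num.sqrt (1 - 4 * s)) / 2.

Lemma kappa_le_half s : kappa s <= 1 / 2.
Proof. by rewrite /kappa; have := sqrtr_ge0 (1 - 4 * s); lra. Qed.

Lemma kappa0 : kappa 0 = 0.
Proof. by rewrite /kappa mulr0 subr0 sqrtr1 subrr mul0r. Qed.

Lemma kappaK s : s <= 1 / 4 -> kappa s * (1 - kappa s) = s.
Proof.
move=> s4; have : 0 <= 1 - 4 * s by lra.
by move=> /sqr_sqrtr; rewrite /kappa; set r := Num.sqrt _; move=> h; nra.
Qed.

Lemma hump_lt x y : x < y -> y <= 1 / 2 -> x * (1 - x) < y * (1 - y).
Proof. by nra. Qed.

Lemma hump_le_quarter x : x * (1 - x) <= 1 / 4.
Proof. by have := sqr_ge0 (2 * x - 1); rewrite expr2; nra. Qed.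

(** Outside the interval from kappa s to 1 - kappa s, the parabola y (1 - y) is
    below s. *)
Lemma kappa_between s x :
  s <= x * (1 - x) -> kappa s <= x /\ x <= 1 - kappa s.
Proof.
move=> sx; have s4 := le_trans sx (hump_le_quarter x).
have kK := kappaK s4; have kh := kappa_le_half s.
split; rewrite leNgt; apply/negP => h.
  by have := hump_lt h kh; rewrite kK; lra.
by have /hump_lt/(_ kh) : 1 - x < kappa s by [lra]; rewrite kK; lra.
Qed.

Lemma hump_ge_kappa s x :
  s <= 1 / 4 -> kappa s <= x -> x <= 1 - kappa s -> s <= x * (1 - x).
Proof. by move=> /kappaK; set q := kappa s; nra. Qed.

Lemma humpK x : x <= 1 / 2 -> kappa (x * (1 - x)) = x.
Proof.
move=> xh; have [h _] := kappa_between (lexx (x * (1 - x))).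
apply/eqP; rewrite eq_le h leNgt; apply/negP => lt.
by have := hump_lt lt xh; rewrite kappaK ?hump_le_quarter// ltxx.
Qed.

Lemma ltr_kappa s t : s < t -> t <= 1 / 4 -> kappa s < kappa t.
Proof.
move=> st t4; rewrite ltNge; apply/negP => h.
have := hump_ge_kappa t4 h; rewrite kappaK; last lra.
have := kappa_le_half s; have := kappa_le_half t; lra.
Qed.

Lemma ler_kappa s t : s <= t -> t <= 1 / 4 -> kappa s <= kappa t.
Proof.
by rewrite le_eqVlt => /predU1P[->//|st] t4; apply/ltW/ltr_kappa.
Qed.

Lemma kappa_ge0 s : 0 <= s -> s <= 1 / 4 -> 0 <= kappa s.
Proof. by move=> s0 s4; rewrite -[leLHS]kappa0 ler_kappa. Qed.

Lemma kappa_gt0 s : 0 < s -> s <= 1 / 4 -> 0 < kappa s.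
Proof. by move=> s0 s4; rewrite -[ltLHS]kappa0 ltr_kappa. Qed.

Lemma kappa_ge_id s : 0 <= s -> s <= 1 / 4 -> s <= kappa s.
Proof.
move=> s0 s4; have := kappaK s4; have := kappa_ge0 s0 s4.
by set q := kappa s; nra.
Qed.

Lemma kappa_continuous : continuous kappa.
Proof.
move=> s; apply: cvgMl; apply: cvgB; first exact: cvg_cst.
apply: (@continuous_comp _ _ _ (fun s => 1 - 4 * s) (@Num.sqrt R)).
  by apply: cvgB; [exact: cvg_cst | apply: cvgMr; exact: cvg_id].
exact: sqrt_continuous.
Qed.

End Kappa.

(** * The equilibrium *)

(** The hub k is an individual of maximal centrality; the equilibrium has level
    mu = 0 only in the star case. *)
Record is_equilibrium (R : realType) (n : nat) (c b : 'cV[R]_n) (k : 'I_n)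
    (mu : R) : Prop := IsEquilibrium {
  eq_simplex : simplex b;
  eq_hump : forall i, b i 0 * (1 - b i 0) = mu * c i 0;
  eq_le_half : forall i, i != k -> b i 0 <= 1 / 2;
  eq_hub_gt0 : 0 < b k 0;
  eq_top : forall i, c i 0 <= c k 0;
  eq_star : 0 < mu \/ [/\ mu = 0, c k 0 = 1 / 2 & b = autocratic R k] }.

(** Choose the hub weight t freely and let the others take the small solution of
    h(y) = h(t) c_i / c_k.  The total mass H t vanishes at t = 0.  Since the small
    solution of h(y) = s is at least s, H t >= 1 at t = c_k / (1 - c_k), which is
    less than 1 outside the star case; the value 1 is reached in between, away from
    the trivial solution t = 1. *)
Lemma equilibrium_exists (R : realType) (n : nat) (c : 'cV[R]_n) :
  (0 < n)%N -> (forall i, 0 < c i 0) -> (forall i, c i 0 <= 1 / 2) ->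
  \sum_i c i 0 = 1 -> exists k b mu, is_equilibrium c b k mu.
Proof.
move=> n0 c0 c_half c1.
have [k ktop] : exists k, forall i, c i 0 <= c k 0.
  case: (arg_maxP (fun i => c i 0) (erefl (predT (Ordinal n0)))) => k _ kP.
  by exists k => i; exact: kP.
have ck0 := c0 k; have ck_half := c_half k; exists k.
have [ck|ck_neq] := eqVneq (c k 0) (1 / 2).
  exists (autocratic R k), 0; split=> //.
  - exact: simplex_autocratic.
  - by move=> i; rewrite autocraticE; case: eqP => _; rewrite /= ?subrr ?mul0r ?mulr0.
  - by move=> i ik; rewrite autocraticE (negbTE ik) divr_ge0.
  - by rewrite autocraticE eqxx.
  - by right.
have ck_lt : c k 0 < 1 / 2 by rewrite lt_neqAle ck_neq.
pose q i := c i 0 / c k 0.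
have q01 i : 0 < q i <= 1 by rewrite divr_gt0//= ler_pdivrMr// mul1r.
pose f i t : R := kappa (t * (1 - t) * q i).
pose H t : R := t + \sum_(i | i != k) f i t.
have Hc : continuous H.
  move=> t; apply: cvgD; first exact: cvg_id.
  apply: continuous_sumR => i {}t.
  suff: {for t, continuous (kappa \o (fun t => t * (1 - t) * q i))} by [].
  apply: continuous_comp.
    apply: cvgMl; apply: cvgM; first exact: cvg_id.
    by apply: cvgB; [exact: cvg_cst|exact: cvg_id].
  exact: kappa_continuous.
have arg_bnd i t : 0 <= t <= 1 -> 0 <= t * (1 - t) * q i <= 1 / 4.
  move=> t01; have := hump_le_quarter t; have := q01 i.
  have : 0 <= t * (1 - t) by nra.
  by set h := t * (1 - t); set r := q i; nra.
(* The q_i sum to 1 / T over i != k, so that H T >= T + h(T) / T = 1. *)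
pose T := c k 0 / (1 - c k 0).
have T01 : 0 < T < 1.
  by rewrite divr_gt0 ?subr_gt0//= ?ltr_pdivrMr ?mul1r ?subr_gt0; lra.
have H0 : H 0 = 0.
  by rewrite /H add0r big1// => i _; rewrite /f !mul0r kappa0.
have HT : 1 <= H T.
  have qsum : \sum_(i | i != k) q i = T^-1.
    by rewrite -mulr_suml (sum_others k c1) invf_div.
  have fT : \sum_(i | i != k) T * (1 - T) * q i <= \sum_(i | i != k) f i T.
    apply: ler_sum => i _; have /andP[? ?] : 0 <= T * (1 - T) * q i <= 1 / 4.
      by apply: arg_bnd; lra.
    exact: kappa_ge_id.
  move: fT; rewrite -mulr_sumr qsum mulrAC mulfV ?mul1r; last by apply/eqP; lra.
  by rewrite /H; lra.
have [t t0T Ht] : exists2 t, t \in `[0, T] & H t = 1.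
  apply: IVT; [by lra|exact: continuous_subspaceT|].
  by rewrite H0 ge_min ler01 le_max HT orbT.
move: t0T; rewrite in_itv /= => /andP[t0 tT].
have {}t0 : 0 < t.
  rewrite lt_neqAle t0 andbT; apply: contra_eq_neq Ht => <-.
  by rewrite H0 eq_sym oner_eq0.
have t01 : 0 <= t <= 1 by lra.
pose b : 'cV[R]_n := \col_i if i == k then t else f i t.
have bk : b k 0 = t by rewrite mxE eqxx.
have bi i : i != k -> b i 0 = f i t by rewrite mxE => /negbTE->.
exists b, (t * (1 - t) / c k 0); split=> //.
- split=> [i|].
    have [->|ik] := eqVneq i k; first by rewrite bk ltW.
    by rewrite bi//; have /andP[? ?] := arg_bnd i t t01; exact: kappa_ge0.
  by rewrite (bigD1 k)//= bk (eq_bigr (fun i => f i t)).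
- move=> i; have [->|ik] := eqVneq i k; first by rewrite bk divfK ?gt_eqF.
  have /andP[? ?] := arg_bnd i t t01.
  by rewrite bi// kappaK// /q mulrA mulrAC.
- by move=> i /bi ->; exact: kappa_le_half.
- by rewrite bk.
- by left; rewrite divr_gt0// mulr_gt0//; lra.
Qed.

(** * Profiles and the states above them *)

(** Raising w to b, and some A >= w by a larger amount to a, gives
    (1 - b) (1 - A) > (1 - a) (1 - w); the relation between h(w) and h(b) trades the
    factors 1 - b and 1 - w for m b and mu w. *)
Lemma hump_ratio_lt (R : realType) (w b A a m mu : R) :
  0 < m -> 0 <= w -> w < b -> w <= A -> b - w < a - A -> w < 1 -> A <= 1 ->
  mu * (w * (1 - w)) = m * (b * (1 - b)) ->
  m * b * (1 - a) < mu * w * (1 - A).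
Proof.
move=> m0 w0 wb wA ba w1 A1 e; rewrite -(@ltr_pM2r _ (1 - w)) ?subr_gt0//.
have -> : mu * w * (1 - A) * (1 - w) = m * (b * (1 - b)) * (1 - A).
  by rewrite -e; ring.
have mb : 0 < m * b by rewrite mulr_gt0// (le_lt_trans w0).
rewrite -subr_gt0 [X in 0 < X](_ : _ =
  (m * b) * ((a - A) * (1 - w) - (b - w) * (1 - A))); last ring.
by apply: mulr_gt0 => //; nra.
Qed.

Section Equilibrium.
Context {R : realType} {n : nat}.
Variables (c b : 'cV[R]_n) (k : 'I_n) (mu : R).
Hypotheses (n3 : (3 <= n)%N) (c_gt0 : forall i, 0 < c i 0).
Hypotheses (c_sum : \sum_i c i 0 = 1) (bE : is_equilibrium c b k mu).

Implicit Type m : R.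

Let b_ge0 i : 0 <= b i 0. Proof. exact: (eq_simplex bE).1. Qed.
Let b_sum : \sum_i b i 0 = 1. Proof. exact: (eq_simplex bE).2. Qed.

Lemma equilibrium_level_ge0 : 0 <= mu.
Proof. by case: (eq_star bE) => [/ltW//|[->]]. Qed.

Lemma sum_others_equilibrium : \sum_(i | i != k) b i 0 = 1 - b k 0.
Proof. exact: sum_others. Qed.

Lemma equilibrium_lt1 i : i != k -> b i 0 < 1.
Proof. by move=> /(eq_le_half bE); lra. Qed.

Lemma equilibrium_gt0 i : 0 < mu -> 0 < b i 0.
Proof.
move=> mu0; rewrite lt_neqAle b_ge0 andbT; apply/eqP => bi.
have /eqP := eq_hump bE i; rewrite -bi mul0r eq_sym mulf_eq0.
by rewrite !gt_eqF.
Qed.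

Lemma equilibrium_pair i j : 0 < mu -> i != j -> b i 0 + b j 0 < 1.
Proof.
move=> mu0 ij; have [l li lj] := third_index i j n3.
rewrite -b_sum (bigD1 i)//= (bigD1 j) 1?eq_sym//= (bigD1 l)/= ?li//.
have := equilibrium_gt0 l mu0.
have : 0 <= \sum_(h < n | (h != i) && (h != j) && (h != l)) b h 0.
  by apply: sumr_ge0.
lra.
Qed.

(** With weights beta_i = c_i / (1 - b_i) of sum B, the equilibrium equations read
    b_i = mu beta_i, 1 - b_k = mu B and c_k = b_k B; they hold in the star case as
    well, where mu = 0. *)
Definition weight i := c i 0 / (1 - b i 0).

Definition total_weight := \sum_(i | i != k) weight i.

Lemma weight_gt0 i : i != k -> 0 < weight i.
Proof. by move=> ik; rewrite divr_gt0// subr_gt0 equilibrium_lt1. Qed.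

Lemma weightK i : i != k -> weight i * (1 - b i 0) = c i 0.
Proof. by move=> ik; rewrite divfK// subr_eq0 gt_eqF// equilibrium_lt1. Qed.

Lemma equilibrium_weight i : i != k -> b i 0 = mu * weight i.
Proof.
move=> ik; apply: (@mulIf _ (1 - b i 0)).
  by rewrite subr_eq0 gt_eqF// equilibrium_lt1.
by rewrite -mulrA weightK// (eq_hump bE).
Qed.

Lemma others_total_weight : 1 - b k 0 = mu * total_weight.
Proof.
rewrite -sum_others_equilibrium /total_weight mulr_sumr.
by apply: eq_bigr => i; exact: equilibrium_weight.
Qed.

Lemma hub_total_weight : c k 0 = b k 0 * total_weight.
Proof.
have [mu0|[mu0 ck bk]] := eq_star bE.
  apply: (@mulfI _ mu); first by rewrite gt_eqF.
  by rewrite -(eq_hump bE) others_total_weight; ring.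
rewrite /total_weight bk autocraticE eqxx mul1r.
rewrite (eq_bigr (fun i => c i 0)) => [|i ik]; first by rewrite (sum_others _ c_sum) ck; lra.
by rewrite /weight bk autocraticE (negbTE ik) subr0 divr1.
Qed.

Lemma weight_lt_total i : i != k -> weight i < total_weight.
Proof.
move=> ik; have [l lk li] := third_index k i n3.
rewrite /total_weight (bigD1 i)//= (bigD1 l) ?lk//=.
rewrite -[ltLHS]addr0 ltrD2l ltr_wpDr ?weight_gt0//.
by apply: sumr_ge0 => j /andP[/andP[jk _] _]; exact/ltW/weight_gt0.
Qed.

(** The small solution of h(p_i) = m c_i, which is a lower barrier of level m. *)
Definition profile (m : R) i := kappa (m * c i 0).

Lemma profile_arg_bounds m i : 0 <= m <= mu -> 0 <= m * c i 0 <= 1 / 4.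
Proof.
move=> /andP[m0 mmu]; rewrite mulr_ge0 ?(ltW (c_gt0 i))//=.
apply: le_trans (hump_le_quarter (b i 0)).
by rewrite (eq_hump bE) ler_wpM2r// ltW.
Qed.

Lemma profile_ge0 m i : 0 <= m <= mu -> 0 <= profile m i.
Proof. by move=> /(profile_arg_bounds i) /andP[? ?]; exact: kappa_ge0. Qed.

Lemma profile_gt0 m i : 0 < m <= mu -> 0 < profile m i.
Proof.
move=> /andP[m0 mmu]; have /(profile_arg_bounds i)/andP[_ ?] : 0 <= m <= mu by rewrite ltW.
by apply: kappa_gt0 => //; rewrite mulr_gt0.
Qed.

Lemma profileK m i : 0 <= m <= mu -> profile m i * (1 - profile m i) = m * c i 0.
Proof. by move=> /(profile_arg_bounds i) /andP[_ ?]; exact: kappaK. Qed.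

Lemma profile_le_half m i : profile m i <= 1 / 2.
Proof. exact: kappa_le_half. Qed.

Lemma profile_le_equilibrium m i : 0 <= m <= mu -> profile m i <= b i 0.
Proof.
move=> /andP[m0 mmu]; apply: (kappa_between _).1.
by rewrite (eq_hump bE) ler_wpM2r// ltW.
Qed.

Lemma profile_lt_equilibrium m i : 0 <= m < mu -> profile m i < b i 0.
Proof.
move=> /andP[m0 mmu].
apply: (@lt_le_trans _ _ (profile mu i)); last first.
  by apply: profile_le_equilibrium; rewrite equilibrium_level_ge0 lexx.
apply: ltr_kappa; first by rewrite ltr_pM2r.
by have /(profile_arg_bounds i)/andP[] : 0 <= mu <= mu by rewrite equilibrium_level_ge0 lexx.
Qed.

Lemma profile_top i : i != k -> profile mu i = b i 0.
Proof. by move=> ik; rewrite /profile -(eq_hump bE) humpK// (eq_le_half bE). Qed.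

Lemma profile_sum_lt1 m : 0 <= m < mu -> \sum_i profile m i < 1.
Proof.
move=> m_mu; rewrite -b_sum; apply: (@sum_lt _ _ _ _ _ k) => // i _.
exact: profile_lt_equilibrium.
Qed.

Let others m := \sum_(i | i != k) profile m i.

Lemma others_le m : 0 <= m <= mu -> others m <= 1 - b k 0.
Proof.
move=> m_mu; rewrite -sum_others_equilibrium.
by apply: ler_sum => i _; exact: profile_le_equilibrium.
Qed.

(** When the level drops from mu to m, every h(p_i) is multiplied by m / mu, but
    h of the sum of the p_i over i != k, which is mu c_k at the level mu, is
    multiplied by more. *)
Lemma hub_gap_hump_strict m :
  0 < m < mu -> m * c k 0 < others m * (1 - others m).
Proof.
move=> /andP[m0 mmu]; have mu0 : 0 < mu by apply: lt_trans mmu.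
have m_mu : 0 <= m <= mu by rewrite !ltW.
have m_mu' : 0 <= m < mu by rewrite ltW.
rewrite -(@ltr_pM2l _ mu)// mulrCA -(eq_hump bE).
rewrite -sum_others_equilibrium [b k 0](_ : _ = 1 - \sum_(i | i != k) b i 0); last first.
  by rewrite sum_others_equilibrium; ring.
set a := \sum_(i | i != k) b i 0.
have -> : m * ((1 - a) * a) = \sum_(i | i != k) m * b i 0 * (1 - a).
  by rewrite -mulr_suml -mulr_sumr -/a; ring.
rewrite [X in _ < mu * (X * _)]/others mulrA mulr_sumr mulr_suml.
have oth_le := others_le m_mu; have bk0 := eq_hub_gt0 bE.
have [l lk _] := third_index k k n3.
apply: (@sum_lt _ _ _ _ _ l) => // i ik; apply: hump_ratio_lt => //.
- exact: profile_ge0.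
- exact: profile_lt_equilibrium.
- rewrite /others (bigD1 i)//= lerDl sumr_ge0// => j _; exact: profile_ge0.
- rewrite /a /others (bigD1 i)//= [X in _ < _ - X](bigD1 i)//= opprD addrACA ltrDl.
  have [h hk hi] := third_index k i n3.
  rewrite subr_gt0; apply: (@sum_lt _ _ _ _ _ h); first by rewrite hk.
  by move=> j _; exact: profile_lt_equilibrium.
- by have := profile_le_half m i; lra.
- by lra.
- by rewrite (eq_hump bE) profileK//; ring.
Qed.

(** At the level mu this is an equality, since h(1 - b_k) = h(b_k). *)
Lemma hub_gap_hump m : 0 <= m <= mu -> m * c k 0 <= others m * (1 - others m).
Proof.
move=> /andP[m0 mmu]; have [->|m_neq0] := eqVneq m 0.
  rewrite mul0r /others big1 ?mul0r// => i _.
  by rewrite /profile mul0r kappa0.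
have m_gt0 : 0 < m by rewrite lt_neqAle eq_sym m_neq0.
have [m_mu|mu_m] := ltP m mu.
  by rewrite ltW// hub_gap_hump_strict// m_gt0.
have -> : m = mu by apply/eqP; rewrite eq_le mmu.
have -> : others mu = 1 - b k 0.
  by rewrite -sum_others_equilibrium; apply: eq_bigr => i; exact: profile_top.
by rewrite -(eq_hump bE) le_eqVlt; apply/orP; left; apply/eqP; ring.
Qed.

(** The largest entry is that of the hub, where [hub_gap_hump] applies. *)
Lemma profile_gap m i :
  0 <= m <= mu -> profile m i <= \sum_(j | j != i) profile m j.
Proof.
move=> m_mu; have [->|ik] := eqVneq i k.
  exact: (kappa_between (hub_gap_hump m_mu)).1.
apply: (@le_trans _ _ (profile m k)).
  have /(profile_arg_bounds k)/andP[_ ?] := m_mu; have /andP[m0 _] := m_mu.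
  by apply: ler_kappa => //; rewrite ler_wpM2l// (eq_top bE).
rewrite (bigD1 k) 1?eq_sym//= lerDl sumr_ge0// => j _; exact: profile_ge0.
Qed.

Lemma profile_gap_strict m i :
  0 < m < mu -> profile m i < \sum_(j | j != i) profile m j.
Proof.
move=> m_mu; have /andP[m0 mmu] := m_mu.
have m_mu' : 0 <= m <= mu by rewrite !ltW.
have [->|ik] := eqVneq i k.
  apply: lt_le_trans (kappa_between (lexx _)).1.
  by apply: ltr_kappa; [exact: hub_gap_hump_strict|exact: hump_le_quarter].
apply: (@le_lt_trans _ _ (profile m k)).
  have /(profile_arg_bounds k)/andP[_ ?] := m_mu'.
  by apply: ler_kappa => //; rewrite ler_pM2l// (eq_top bE).
have [l li lk] := third_index i k n3.
rewrite (bigD1 k) 1?eq_sym//= ltrDl (bigD1 l) ?li//= ltr_wpDr//.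
  by apply: sumr_ge0 => j _; exact: profile_ge0.
by apply: profile_gt0; rewrite m0 ltW.
Qed.

Definition level_set (m : R) : set 'cV[R]_n :=
  [set x | simplex x /\ forall i, profile m i <= x i 0].

Lemma level_set_le_others m x i :
  level_set m x -> x i 0 <= 1 - \sum_(j | j != i) profile m j.
Proof.
move=> [[x0 x1] px]; rewrite lerBrDr -x1 [leRHS](bigD1 i)//= lerD2l.
by apply: ler_sum => j _; exact: px.
Qed.

(** The upper bound x_i <= 1 - p_i comes for free: the others keep at least the
    mass of their profiles, which is at least p_i. *)
Lemma level_set_hump m x i :
  0 <= m <= mu -> level_set m x -> m * c i 0 <= x i 0 * (1 - x i 0).
Proof.
move=> m_mu xm; have /(profile_arg_bounds i)/andP[_ ?] := m_mu.
apply: hump_ge_kappa => //; first exact: xm.2.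
have := level_set_le_others i xm; have := profile_gap i m_mu.
by rewrite -/(profile m i); lra.
Qed.

Lemma level_set_of_hump m x :
  simplex x -> (forall i, m * c i 0 <= x i 0 * (1 - x i 0)) -> level_set m x.
Proof. by move=> xD xh; split=> // i; exact: (kappa_between (xh i)).1. Qed.

Lemma level_set_hump_eq m x i : 0 < m < mu -> level_set m x ->
  x i 0 * (1 - x i 0) = m * c i 0 -> x i 0 = profile m i.
Proof.
move=> m_mu xm e; have /andP[m0 mmu] := m_mu.
have m_mu' : 0 <= m <= mu by rewrite !ltW.
have := profileK i m_mu'; have := level_set_le_others i xm.
have := profile_gap_strict i m_mu; have := xm.2 i.
set p := profile m i; set S := \sum_(j | _) _; move=> h1 h2 h3 h4.
have : (x i 0 - p) * (1 - x i 0 - p) = 0.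
  by rewrite -[RHS](subrr (m * c i 0)) -{1}e -h4; ring.
by move=> /eqP; rewrite mulf_eq0 => /orP[/eqP|/eqP]; lra.
Qed.

Lemma excess_ge0 x i : level_set mu x -> i != k -> 0 <= x i 0 - b i 0.
Proof. by move=> xm ik; rewrite subr_ge0 -(profile_top ik) xm.2. Qed.

Lemma excess_sum x :
  level_set mu x -> \sum_(i | i != k) (x i 0 - b i 0) = b k 0 - x k 0.
Proof.
by move=> xm; rewrite sumrB (sum_others k xm.1.2) sum_others_equilibrium; ring.
Qed.

(** Above the level mu, what the others have in excess of the equilibrium is
    missing at the hub. *)
Lemma excess_le x i :
  level_set mu x -> i != k -> x i 0 - b i 0 <= b k 0 - x k 0.
Proof.
move=> xm ik; rewrite -excess_sum// (bigD1 i)//= lerDl sumr_ge0// => j.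
by case/andP => jk _; exact: excess_ge0.
Qed.

Lemma level_set_eq_equilibrium x :
  level_set mu x -> b k 0 <= x k 0 -> x = b.
Proof.
move=> xm bk; apply: simplex_le_eq => //; first exact: xm.1.
move=> i; have [->//|ik] := eqVneq i k.
by rewrite -subr_ge0 excess_ge0.
Qed.

End Equilibrium.

(** Take for m the minimum of mu and of the ratios h(x_i) / c_i. *)
Lemma interior_level_set (R : realType) (n : nat) (c x : 'cV[R]_n) (mu : R) :
  (3 <= n)%N -> (forall i, 0 < c i 0) -> 0 < mu -> simplex x ->
  (forall i, 0 < x i 0) -> exists2 m, 0 < m <= mu & level_set c m x.
Proof.
move=> n3 c_gt0 mu0 xD x0.
have x1 i : x i 0 < 1.
  have [j ji _] := third_index i i n3.
  have := sum_others i xD.2; rewrite (bigD1 j)//=.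
  have : 0 <= \sum_(l | (l != i) && (l != j)) x l 0 by apply: sumr_ge0 => l _; exact: ltW.
  by have := x0 j; lra.
pose q i := x i 0 * (1 - x i 0) / c i 0.
have q0 i : 0 < q i by rewrite divr_gt0 ?mulr_gt0 ?subr_gt0.
have k : 'I_n by apply: (@Ordinal n 0); apply: leq_trans n3.
case: (arg_minP q (erefl (predT k))) => i _ imin.
exists (Num.min mu (q i)); first by rewrite lt_min mu0 q0 ge_min lexx.
apply: level_set_of_hump => // j; rewrite -ler_pdivlMr//.
by apply: le_trans (imin j isT); rewrite ge_min lexx orbT.
Qed.

Section LevelSetLimit.
Context {R : realType} {n : nat}.
Variables (C : 'M[R]_n) (c b : 'cV[R]_n) (k : 'I_n) (mu : R).
Hypotheses (n3 : (3 <= n)%N) (C_irr : irreducible C).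
Hypotheses (c_gt0 : forall i, 0 < c i 0).
Hypothesis bE : is_equilibrium c b k mu.

(** A state above a profile of level m < mu can touch it at i only if the previous
    state touched it at i and at all in-neighbours of i. *)
Definition touches_back (G : 'cV[R]_n -> 'cV[R]_n -> Prop) :=
  forall m y z i, 0 < m < mu -> level_set c m y -> G y z ->
  z i 0 = profile c m i ->
  y i 0 = profile c m i /\ forall j, 0 < C j i -> y j 0 = profile c m j.

(** Let m be the minimum of h(z_i) / c_i over z in L and i; it is attained by a
    contact with the profile of level m.  If m < mu, going back in time inside L
    accumulates contacts along the arcs of C, hence at all individuals by
    irreducibility, and the sum of the profile would be 1. *)
Lemma limit_in_level_set (L : set 'cV[R]_n) (G : 'cV[R]_n -> 'cV[R]_n -> Prop)
    (m0 : R) :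
  compact L -> L !=set0 -> (forall z, L z -> exists2 y, L y & G y z) ->
  touches_back G -> 0 < m0 <= mu -> L `<=` level_set c m0 ->
  L `<=` level_set c mu.
Proof.
move=> cL L0 Lpred touch /andP[m0_gt0 m0_mu] Lm0.
have m0_in : 0 <= m0 <= mu by rewrite ltW.
pose q i (z : 'cV[R]_n) := z i 0 * (1 - z i 0) / c i 0.
have q_cont i : continuous (q i).
  apply: (@continuous_mulR R _ (fun z : 'cV[R]_n => z i 0 * (1 - z i 0))
    (fun _ => (c i 0)^-1)); last exact: continuous_cstR.
  apply: (@continuous_mulR R _ (fun z : 'cV[R]_n => z i 0)); first exact: continuous_coord.
  by apply: continuous_subR; [exact: continuous_cstR|exact: continuous_coord].
have argmin i : exists z, L z /\ forall z', L z' -> q i z <= q i z'.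
  have [|z /set_mem Lz zmin] := @compact_EVT_min _ R (q i) L L0 cL.
    exact/continuous_subspaceT/q_cont.
  by exists z; split=> // z' Lz'; apply: zmin; rewrite inE.
pose zmin i := projT1 (cid (argmin i)).
have zminP i : L (zmin i) /\ forall z', L z' -> q i (zmin i) <= q i z'.
  exact: projT2 (cid (argmin i)).
have [i imin] : exists i, forall j, q i (zmin i) <= q j (zmin j).
  case: (arg_minP (fun i => q i (zmin i)) (erefl (predT k))) => i _ iP.
  by exists i => j; exact: iP.
set m := q i (zmin i) in imin; set z := zmin i in m imin *.
have Lz : L z := (zminP i).1.
have m_min z' j : L z' -> m * c j 0 <= z' j 0 * (1 - z' j 0).
  move=> Lz'; rewrite -ler_pdivlMr//; apply: le_trans (imin j) _.
  exact: (zminP j).2.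
have simplexL z' : L z' -> simplex z' by move=> /Lm0[].
have [mu_m|m_mu] := leP mu m.
  move=> z' Lz'; apply: level_set_of_hump; first exact: simplexL.
  by move=> j; apply: le_trans (m_min _ _ Lz'); rewrite ler_pM2r.
have m_gt0 : 0 < m.
  apply: lt_le_trans m0_gt0 _; rewrite /m /q ler_pdivlMr//.
  by apply: (level_set_hump n3 c_gt0 bE) => //; exact: Lm0.
have m_in : 0 < m < mu by rewrite m_gt0.
have Lm : L `<=` level_set c m.
  by move=> z' Lz'; apply: level_set_of_hump => [|j]; [exact: simplexL|exact: m_min].
have zi : z i 0 = profile c m i.
  apply: (level_set_hump_eq n3 c_gt0 bE) => //; first exact: Lm.
  by rewrite /m /q divfK ?gt_eqF.
pose T (y : 'cV[R]_n) j := y j 0 = profile c m j.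
have back j s y : path [rel l h | 0 < C l h] j s -> L y -> T y (last j s) ->
    exists y', [/\ L y', T y' j & forall h, T y h -> T y' h].
  elim: s j => [|j' s IHs] j /=; first by move=> _ Ly Tj; exists y.
  move=> /andP[Cjj' sP] Ly Tl; have [y' [Ly' Tj' sub]] := IHs _ sP Ly Tl.
  have [x Lx Gxy'] := Lpred _ Ly'.
  have tb h := touch m x y' h m_in (Lm _ Lx) Gxy'.
  exists x; split=> // [|h /sub Th]; first exact: (tb _ Tj').2.
  exact: (tb _ Th).1.
have [y [Ly _ Ty]] : exists y,
    [/\ L y, T y i & forall j, j \in enum 'I_n -> T y j].
  elim: (enum 'I_n) => [|j l [y [Ly Ti Tl]]]; first by exists z.
  have /connectP[s sP iE] := C_irr j i.
  have [|y' [Ly' Tj' sub]] := back j s y sP Ly; first by rewrite -iE.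
  exists y'; split=> // [|h]; first exact: sub.
  by rewrite inE => /predU1P[->//|/Tl/sub].
have : \sum_j profile c m j < 1.
  by apply: (profile_sum_lt1 c_gt0 bE); rewrite ltW.
rewrite -(simplexL _ Ly).2 (eq_bigr (fun j => y j 0)) ?ltxx// => j _.
by apply/esym/Ty; rewrite mem_enum.
Qed.

End LevelSetLimit.

(** * A convergence criterion for both systems *)

Section Convergence.
Context {R : realType} {n : nat}.
Variables (C : 'M[R]_n) (c b : 'cV[R]_n) (k : 'I_n) (mu : R).
Hypotheses (n3 : (3 <= n)%N) (C_irr : irreducible C).
Hypotheses (c_gt0 : forall i, 0 < c i 0).
Hypothesis bE : is_equilibrium c b k mu.

(** In the star case the profile of level mu = 0 vanishes, and the condition on z_k
    excludes the face of the simplex opposite to the hub. *)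
Definition trapping_set : set 'cV[R]_n := [set z | level_set c mu z /\ 0 < z k 0].

Lemma level_set_equilibrium z : b k 0 <= 1 / 2 -> level_set c mu z -> z = b.
Proof.
move=> bk [zD zp]; apply: simplex_le_eq => // [|i]; first exact: eq_simplex bE.
suff <- : profile c mu i = b i 0 by [].
rewrite /profile -(eq_hump bE) humpK//; have [->//|] := eqVneq i k.
exact: eq_le_half bE _.
Qed.

(** Strictness is required over two steps only, as in [lyapunov_collapse]. *)
Definition lyapunov_for (G : 'cV[R]_n -> 'cV[R]_n -> Prop)
    (W : 'cV[R]_n -> R) :=
  [/\ continuous W,
      forall z, trapping_set z -> z <> b -> W b < W z,
      forall y z, trapping_set y -> trapping_set z -> G y z -> W z <= W y &
      forall w y z, trapping_set w -> trapping_set y -> G w y -> G y z ->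
        W y = W w -> W z = W y -> y = b].

Variables (G : 'cV[R]_n -> 'cV[R]_n -> Prop) (x : nat -> 'cV[R]_n).
Hypotheses (x_simplex : forall t, simplex (x t)) (G_closed : closed_rel G).
Hypotheses (G_orbit : forall t, G (x t) (x t.+1)) (G_touch : touches_back C c mu G).
Hypothesis x_level : 0 < mu ->
  exists2 m, 0 < m <= mu & \forall t \near \oo, level_set c m (x t).
Hypothesis x_hub : mu = 0 ->
  exists2 e, 0 < e & \forall t \near \oo, e <= x t k 0.

Let x01 t i : 0 <= x t i 0 <= 1.
Proof. by rewrite (x_simplex t).1 simplex_le1. Qed.

Lemma limit_set_trapped : limit_set x `<=` trapping_set.
Proof.
have L_simplex : limit_set x `<=` [set z | simplex z].
  by apply: limit_set_sub; [exact: closed_simplex|exact: nearW].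
have [mu0|[mu0 _ _]] := eq_star bE.
  have [m /andP[m0 mmu] xm] := x_level mu0.
  have L_m : limit_set x `<=` level_set c m.
    by apply: limit_set_sub => //; apply: closedI;
      [exact: closed_simplex|exact: closed_lower_bound].
  have L_mu : limit_set x `<=` level_set c mu.
    apply: (limit_in_level_set n3 C_irr c_gt0 bE _ _ _ G_touch) L_m.
    - exact: limit_set_compact.
    - exact: limit_set_nonempty.
    - by move=> z; exact: limit_set_pred.
    - by rewrite m0.
  move=> z Lz; split; first exact: L_mu.
  by apply: lt_le_trans ((L_mu _ Lz).2 k); apply: (profile_gt0 c_gt0 bE); rewrite mu0 /=.
have [e e0 xe] := x_hub mu0.
move=> z Lz; split.
  split; first exact: L_simplex.
  by move=> i; rewrite /profile mu0 mul0r kappa0; exact: (L_simplex _ Lz).1.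
apply: lt_le_trans e0 _.
have /(_ _ Lz)/(_ k) : limit_set x `<=` [set z | forall i, (if i == k then e else 0) <= z i 0].
  apply: limit_set_sub; first exact: closed_lower_bound.
  by apply: filterS xe => t te i; case: eqP => [->//|_]; exact: (x_simplex t).1.
by rewrite eqxx.
Qed.

(** When b_k <= 1/2 the barrier alone pins down the limit points. *)
Lemma lyapunov_convergence :
  (1 / 2 < b k 0 -> exists W, lyapunov_for G W) ->
  x @ \oo --> b.
Proof.
move=> Wex; apply: limit_set_cvg => //.
have [bk|bk] := leP (b k 0) (1 / 2).
  by move=> z /limit_set_trapped[+ _]; exact: level_set_equilibrium.
have [W [Wc Wb Wmono Wstrict]] := Wex bk.
apply: (@lyapunov_collapse _ _ _ G W) => //.
- exact: limit_set_compact.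
- by move=> z; exact: limit_set_pred.
- by move=> z /limit_set_trapped; exact: Wb.
- by move=> y z /limit_set_trapped ? /limit_set_trapped; exact: Wmono.
- by move=> w y z /limit_set_trapped ? /limit_set_trapped ? ?; exact: Wstrict.
Qed.

End Convergence.

(** * The single-timescale system *)

(** The last factor is the rate at which an excess x - bi of an individual over its
    equilibrium is dissipated, when the hub has weight xk and its equilibrium is
    1 - a. *)
Lemma excess_factor_ge (R : realType) (g x xk a bi : R) :
  bi <= a -> a < 1 / 2 -> a <= xk -> 0 <= g -> 1 - 2 * a <= g * (1 - 2 * bi) ->
  x <= 1 - xk - a + bi ->
  2 * (a - bi) * (1 - a - xk) <= (1 - 2 * bi) * (g * (1 - x - bi) + (a - xk)).
Proof.
move=> ba a2 ak g0 gb xle.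
have h1 : g * (xk + a - 2 * bi) <= g * (1 - x - bi) by apply: ler_wpM2l => //; lra.
have h2 : (1 - 2 * a) * (xk + a - 2 * bi) <= g * (1 - 2 * bi) * (xk + a - 2 * bi).
  by apply: ler_wpM2r => //; lra.
have h3 : 0 <= 1 - 2 * bi by lra.
have := ler_wpM2l h3 h1; nra.
Qed.

Section SingleTimescale.
Context {R : realType} {n : nat}.
Variables (C : 'M[R]_n) (c : 'cV[R]_n).
Hypotheses (n3 : (3 <= n)%N) (C_stoch : row_stochastic C).
Hypotheses (C_irr : irreducible C) (C_diag : forall i, C i i = 0).
Hypothesis c_dom : dominant_left C c.
Let c_gt0 := centrality_gt0 C_stoch C_irr c_dom.
Let c_sum := centrality_sum1 c_dom.

Lemma stdf_stepE x i :
  stdf_step C x i 0 = \sum_j C j i * (x j 0 * (1 - x j 0)) + x i 0 ^+ 2.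
Proof.
rewrite !mxE; congr (_ + _); apply: eq_bigr => j _; rewrite !mxE; ring.
Qed.

Implicit Type x : 'cV[R]_n.

Let hump_ge0 x i : simplex x -> 0 <= x i 0 * (1 - x i 0).
Proof. by move=> xD; rewrite mulr_ge0 ?(xD.1 i)// subr_ge0 simplex_le1. Qed.

Lemma stdf_simplex x : simplex x -> simplex (stdf_step C x).
Proof.
move=> xD; split=> [i|].
  rewrite stdf_stepE addr_ge0 ?sqr_ge0// sumr_ge0// => j _.
  by rewrite mulr_ge0 ?hump_ge0// C_stoch.1.
under eq_bigr do rewrite stdf_stepE.
rewrite big_split /= exchange_big /= -[RHS]xD.2 -big_split /=.
by apply: eq_bigr => j _; rewrite -mulr_suml C_stoch.2; ring.
Qed.

Lemma stdf_closed : closed_rel (fun u w : 'cV[R]_n => w = stdf_step C u).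
Proof.
pose g (i : 'I_n) (p : 'cV[R]_n * 'cV[R]_n) := p.2 i 0 - stdf_step C p.1 i 0.
rewrite /closed_rel (_ : mkset _ = [set p | forall i, g i p = 0]).
  apply: closed_zeros => i; apply: continuous_subR; first exact: continuous_snd_coord.
  rewrite (_ : (fun p => _) = (fun p : 'cV[R]_n * 'cV[R]_n =>
    \sum_j C j i * (p.1 j 0 * (1 - p.1 j 0)) - (0 - p.1 i 0 * p.1 i 0))).
    apply: continuous_subR; last first.
      apply: continuous_subR; first exact: continuous_cstR.
      by apply: continuous_mulR; exact: continuous_fst_coord.
    apply: continuous_sumR => j; apply: continuous_mulR; first exact: continuous_cstR.
    apply: continuous_mulR; first exact: continuous_fst_coord.
    by apply: continuous_subR;
      [exact: continuous_cstR|exact: continuous_fst_coord].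
  by apply/funext => p; rewrite stdf_stepE; ring.
apply/seteqP; split=> -[u w] /=; rewrite /g /=.
  by move=> -> i; rewrite subrr.
by move=> h; apply/colP => i; apply/eqP; rewrite -subr_eq0 h.
Qed.

Lemma stdf_pos x i : simplex x -> 0 < x i 0 -> 0 < stdf_step C x i 0.
Proof.
move=> xD xi; rewrite stdf_stepE ltr_wpDl ?exprn_gt0// sumr_ge0// => j _.
by rewrite mulr_ge0 ?hump_ge0// C_stoch.1.
Qed.

Lemma stdf_pos_succ x i j :
  simplex x -> 0 < x i 0 < 1 -> 0 < C i j -> 0 < stdf_step C x j 0.
Proof.
move=> xD /andP[x0 x1] Cij; rewrite stdf_stepE ltr_pwDl ?sqr_ge0//.
rewrite (bigD1 i)//= ltr_pwDl ?mulr_gt0 ?subr_gt0//.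
by apply: sumr_ge0 => l _; rewrite mulr_ge0 ?hump_ge0// C_stoch.1.
Qed.

(** Positive weights persist, so a step that reaches an autocratic state must start
    from it. *)
Lemma stdf_lt1 x :
  simplex x -> (forall i, x i 0 < 1) -> forall i, stdf_step C x i 0 < 1.
Proof.
move=> xD x1 i; have FD := stdf_simplex xD.
rewrite lt_neqAle simplex_le1// andbT; apply/eqP => Fi.
have := x1 i; rewrite -xD.2 (bigD1 i)//= big1 ?addr0 ?ltxx// => j ji.
apply/eqP; rewrite eq_le xD.1 andbT leNgt; apply/negP => /(stdf_pos xD).
have := sum_others i FD.2; rewrite Fi subrr => /psumr_eq0P -> //.
  by rewrite ltxx.
by move=> l _; exact: FD.1.
Qed.

Let orbit_simplex x t : simplex x -> simplex (iter t (stdf_step C) x).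
Proof. by move=> xD; elim: t => //= t; exact: stdf_simplex. Qed.

(** Positivity persists, and it spreads along the arcs of C from an individual
    whose weight lies strictly between 0 and 1. *)
Lemma stdf_interior x : simplex x -> (forall i, x i 0 < 1) ->
  exists T, forall t i, (T <= t)%N -> 0 < iter t (stdf_step C) x i 0.
Proof.
move=> xD x1; pose y t := iter t (stdf_step C) x.
have yD t : simplex (y t) by exact: orbit_simplex.
have y1 t : forall i, y t i 0 < 1 by elim: t => //= t; exact: stdf_lt1.
have y_path s t i : path [rel l h | 0 < C l h] i s -> 0 < y t i 0 ->
    0 < y (size s + t)%N (last i s) 0.
  elim: s t i => [//|j s IHs] t i /= /andP[Cij sP] yi.
  have := IHs t.+1 j sP; rewrite addnS; apply.
  by apply: (stdf_pos_succ (yD t) _ Cij); rewrite yi y1.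
have [i xi] : exists i, 0 < x i 0.
  apply: contrapT => xn; have := xD.2; rewrite big1 => [/esym/eqP|i _].
    by rewrite oner_eq0.
  apply/eqP; rewrite eq_le xD.1 andbT leNgt; apply/negP => xi.
  by apply: xn; exists i.
have reach j : exists t, 0 < y t j 0.
  by have /connectP[s /(y_path s 0%N) sP ->] := C_irr i j; exists (size s + 0)%N; exact: sP.
pose T j := projT1 (cid (reach j)).
have yT j : 0 < y (T j) j 0 := projT2 (cid (reach j)).
exists (\max_j T j) => t j /(leq_trans (leq_bigmax j))/subnK <-.
elim: (t - T j)%N => [|d IHd]; first by rewrite add0n; exact: yT.
by apply: stdf_pos IHd; exact: yD.
Qed.

Variables (b : 'cV[R]_n) (k : 'I_n) (mu : R).
Hypothesis bE : is_equilibrium c b k mu.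

Lemma stdf_fixed : stdf_step C b = b.
Proof.
apply/colP => i; rewrite stdf_stepE.
under eq_bigr do rewrite (eq_hump bE) mulrCA.
by rewrite -mulr_sumr (centrality_fix c_dom) -(eq_hump bE); ring.
Qed.

(** Since c is invariant, the contribution m c_i of the level can be split off,
    and what remains is nonnegative above the profile of level m. *)
Lemma stdf_step_level m x i :
  stdf_step C x i 0 = x i 0 ^+ 2 + m * c i 0 +
    \sum_j C j i * (x j 0 * (1 - x j 0) - m * c j 0).
Proof.
rewrite stdf_stepE -(centrality_fix c_dom i) mulr_sumr -addrA -big_split /= addrC.
by congr (_ + _); apply: eq_bigr => j _; ring.
Qed.

Lemma stdf_level m x :
  0 <= m <= mu -> level_set c m x -> level_set c m (stdf_step C x).
Proof.
move=> m_mu xm; split; first exact: stdf_simplex xm.1.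
move=> i; rewrite (stdf_step_level m).
have : 0 <= \sum_j C j i * (x j 0 * (1 - x j 0) - m * c j 0).
  apply: sumr_ge0 => j _; rewrite mulr_ge0 ?C_stoch.1// subr_ge0.
  exact: (level_set_hump n3 c_gt0 bE).
have := profile_ge0 c_gt0 bE i m_mu; have := profileK c_gt0 bE i m_mu.
have := xm.2 i; set p := profile c m i; nra.
Qed.

(** An entry at the barrier leaves no room for the nonnegative terms of
    [stdf_step_level]. *)
Lemma stdf_touch : touches_back C c mu (fun u w => w = stdf_step C u).
Proof.
move=> m y z i m_in ym -> ; have /andP[m0 mmu] := m_in.
have m_mu : 0 <= m <= mu by rewrite !ltW.
have term_ge0 j : 0 <= C j i * (y j 0 * (1 - y j 0) - m * c j 0).
  rewrite mulr_ge0 ?C_stoch.1// subr_ge0.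
  exact: (level_set_hump n3 c_gt0 bE).
rewrite (stdf_step_level m); set S := \sum_j _.
have S0 : 0 <= S by apply: sumr_ge0.
have p0 : 0 < profile c m i by apply: (profile_gt0 c_gt0 bE); rewrite m0 ltW.
have pK := profileK c_gt0 bE i m_mu; have yi := ym.2 i.
move: p0 pK yi; set p := profile c m i => p0 pK yi e.
have yip : y i 0 = p by apply/eqP; rewrite eq_le yi andbT; nra.
split=> // j Cji; have {}S0 : S = 0 by move: e; rewrite yip -pK; lra.
have /eqP : C j i * (y j 0 * (1 - y j 0) - m * c j 0) = 0.
  exact: (psumr_eq0P _ S0).
rewrite mulf_eq0 (gt_eqF Cji)/= subr_eq0 => /eqP.
exact: (level_set_hump_eq n3 c_gt0 bE).
Qed.


(** The function v is strictly superharmonic away from k, so its minimum is at k. *)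
Lemma min_principle (v g : 'I_n -> R) :
  (forall i, v i - \sum_j C i j * v j = g i) ->
  (forall i, i != k -> 0 < g i) -> forall i, i != k -> v k < v i.
Proof.
move=> vg g_gt0.
case: (arg_minP v (erefl (predT k))) => m _ mmin.
have not_min i : i != k -> (forall j, v i <= v j) -> False.
  move=> ik imin; have := g_gt0 i ik; rewrite -vg subr_gt0.
  apply/negP; rewrite -leNgt -[leLHS]mul1r -(C_stoch.2 i) mulr_suml.
  by apply: ler_sum => j _; rewrite ler_wpM2l// C_stoch.1.
have mk : m = k.
  by have [//|mk] := eqVneq m k; case: (not_min m mk) => j; exact: mmin.
move=> i ik; rewrite ltNge; apply/negP => vik.
by apply: (not_min i ik) => j; apply: le_trans vik _; rewrite -mk; exact: mmin.
Qed.

Lemma weighted_sum_sub (v x y : 'I_n -> R) : \sum_i x i = \sum_i y i ->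
  \sum_i v i * x i - \sum_i v i * y i =
  \sum_(i | i != k) (v i - v k) * (x i - y i).
Proof.
move=> xy; rewrite -sumrB (bigD1 k)//=.
have -> : v k * x k - v k * y k = \sum_(i | i != k) - v k * (x i - y i).
  rewrite -mulr_sumr sumrB (sum_others k (erefl (\sum_i x i))).
  by rewrite (sum_others k (erefl (\sum_i y i))) xy; ring.
by rewrite -big_split; apply: eq_bigr => i _ /=; ring.
Qed.

Lemma potential_gt (v : 'I_n -> R) x : (forall i, i != k -> v k < v i) ->
  level_set c mu x -> x <> b ->
  \sum_i v i * b i 0 < \sum_i v i * x i 0.
Proof.
move=> vk xm xb; rewrite -subr_gt0 weighted_sum_sub; last first.
  by rewrite xm.1.2 (eq_simplex bE).2.
have d0 i := @excess_ge0 _ _ _ _ _ _ bE x i xm.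
have term_ge0 i : i != k -> 0 <= (v i - v k) * (x i 0 - b i 0).
  by move=> ik; rewrite mulr_ge0 ?d0// subr_ge0 ltW// vk.
rewrite lt_neqAle sumr_ge0 ?andbT//; apply/eqP => /esym s0; apply: xb.
have xi i : i != k -> x i 0 = b i 0.
  move=> ik; have /eqP := psumr_eq0P term_ge0 s0 ik.
  by rewrite mulf_eq0 gt_eqF ?subr_gt0 ?vk//= subr_eq0 => /eqP.
apply/colP => i; have [->|] := eqVneq i k; last exact: xi.
have := xm.1.2; rewrite -(eq_simplex bE).2 (bigD1 k)//= [RHS](bigD1 k)//=.
by rewrite (eq_bigr (fun i => b i 0))// => /addIr.
Qed.

Section NotStar.
Hypotheses (mu0 : 0 < mu) (bk : 1 / 2 < b k 0).
Let a : R := 1 - b k 0.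

Let b_lt_a i : i != k -> b i 0 < a.
Proof. by move=> ik; have := equilibrium_pair n3 c_gt0 bE mu0 ik; rewrite /a; lra. Qed.

Let hub_ge x : level_set c mu x -> a <= x k 0.
Proof.
move=> xm; apply: le_trans (xm.2 k); rewrite /profile -(eq_hump bE).
have -> : b k 0 * (1 - b k 0) = a * (1 - a) by rewrite /a; ring.
by rewrite humpK//; move: bk; rewrite /a; lra.
Qed.

(** The critical weights (1 - 2 a) / (1 - 2 b_i) pair with c to at most c_k; scale
    them up so as to get exactly c_k. *)
Lemma dissipative_weights_exist : exists g : 'I_n -> R,
  [/\ g k = - 1, forall i, i != k -> 0 < g i,
      forall i, i != k -> 1 - 2 * a <= g i * (1 - 2 * b i 0) &
      \sum_i g i * c i 0 = 0].
Proof.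
pose G i := (1 - 2 * a) / (1 - 2 * b i 0).
have a2 : a < 1 / 2 by move: bk; rewrite /a; lra.
have b2 i : i != k -> 0 < 1 - 2 * b i 0 by move=> /b_lt_a; lra.
have G0 i : i != k -> 0 < G i by move=> ik; rewrite divr_gt0 ?b2//; lra.
pose S := \sum_(i | i != k) G i * c i 0.
have [l lk _] := third_index k k n3.
have S0 : 0 < S.
  rewrite /S (bigD1 l)//= ltr_wpDr ?(mulr_gt0 (G0 l lk) (c_gt0 l))//.
  by apply: sumr_ge0 => i /andP[ik _]; rewrite mulr_ge0 ?ltW ?G0.
have S_le : S <= c k 0.
  rewrite (hub_total_weight c_sum bE) /total_weight mulr_sumr; apply: ler_sum => i ik.
  rewrite -(weightK bE ik) mulrCA mulrC ler_wpM2r ?(ltW (weight_gt0 c_gt0 bE ik))//.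
  rewrite /G mulrAC ler_pdivrMr ?b2//.
  have := b_lt_a ik; have : b k 0 = 1 - a by rewrite /a; ring.
  by move=> ->; nra.
exists (fun i => if i == k then -1 else c k 0 / S * G i); split=> [|i ik|i ik|].
- by rewrite eqxx.
- by rewrite (negbTE ik) (mulr_gt0 _ (G0 i ik))// divr_gt0.
- rewrite (negbTE ik) -mulrA /G divfK ?gt_eqF ?b2//.
  by rewrite ler_peMl ?ler_pdivlMr ?mul1r//; lra.
- rewrite (bigD1 k)//= eqxx (eq_bigr (fun i => c k 0 / S * (G i * c i 0))).
    by rewrite -mulr_sumr -/S divfK ?gt_eqF//; ring.
  by move=> i /negbTE->; rewrite -mulrA.
Qed.

(** As g is orthogonal to c, h(x_i) may be replaced by h(x_i) - h(b_i), which
    factors as (x_i - b_i) (1 - x_i - b_i).  Expressing the deficit of the hub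
    through the excesses of the others leaves a sum of nonnegative terms. *)
Lemma dissipation (g : 'I_n -> R) x : g k = -1 -> (forall i, i != k -> 0 < g i) ->
  (forall i, i != k -> 1 - 2 * a <= g i * (1 - 2 * b i 0)) ->
  \sum_i g i * c i 0 = 0 -> level_set c mu x ->
  0 <= \sum_i g i * (x i 0 * (1 - x i 0)) /\
  (\sum_i g i * (x i 0 * (1 - x i 0)) = 0 -> x = b).
Proof.
move=> gk g0 gb gc xm; have [xD xp] := xm.
pose br i := g i * (1 - x i 0 - b i 0) + (a - x k 0).
have a2 : a < 1 / 2 by move: bk; rewrite /a; lra.
have d_sum := excess_sum bE xm.
have -> : \sum_i g i * (x i 0 * (1 - x i 0)) =
    \sum_(i | i != k) (x i 0 - b i 0) * br i.
  transitivity (\sum_i g i * (x i 0 * (1 - x i 0) - mu * c i 0)).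
    under [RHS]eq_bigr do rewrite mulrBr [g _ * (mu * _)]mulrCA.
    by rewrite sumrB -mulr_sumr gc mulr0 subr0.
  rewrite (bigD1 k)//= gk.
  have -> : -1 * (x k 0 * (1 - x k 0) - mu * c k 0) =
      \sum_(i | i != k) (x i 0 - b i 0) * (a - x k 0).
    by rewrite -mulr_suml d_sum -(eq_hump bE) /a; ring.
  rewrite -big_split; apply: eq_bigr => i ik /=.
  by rewrite -(eq_hump bE) /br; ring.
have d0 i := @excess_ge0 _ _ _ _ _ _ bE x i xm.
have x_le i : i != k -> x i 0 <= 1 - x k 0 - a + b i 0.
  by move=> ik; have := excess_le bE xm ik; rewrite /a; lra.
have br_ge i : i != k ->
    2 * (a - b i 0) * (1 - a - x k 0) <= (1 - 2 * b i 0) * br i.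
  move=> ik; apply: excess_factor_ge => //;
    [exact/ltW/b_lt_a|exact: hub_ge|exact/ltW/g0|exact: gb|exact: x_le].
have xk_le : 0 <= 1 - a - x k 0.
  have -> : 1 - a = b k 0 by rewrite /a; ring.
  by rewrite -d_sum sumr_ge0.
have term_ge0 i : i != k -> 0 <= (x i 0 - b i 0) * br i.
  move=> ik; rewrite mulr_ge0 ?d0//; have := br_ge i ik; have := b_lt_a ik.
  by move=> h1 h2; rewrite -(@pmulr_rge0 _ (1 - 2 * b i 0)); [nra|lra].
split; first exact: sumr_ge0.
move=> s0; have di i : i != k -> x i 0 = b i 0.
  move=> ik; have /eqP := psumr_eq0P term_ge0 s0 ik.
  rewrite mulf_eq0 => /orP[|/eqP br0]; first by rewrite subr_eq0 => /eqP.
  have := br_ge i ik; rewrite br0 mulr0 => h; have := b_lt_a ik => hb.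
  have xk : 1 - a - x k 0 = 0 by apply/eqP; rewrite eq_le xk_le andbT; nra.
  have s1 : \sum_(i | i != k) (x i 0 - b i 0) = 0 by rewrite d_sum; move: xk; rewrite /a; lra.
  by have /eqP := psumr_eq0P d0 s1 ik; rewrite subr_eq0 => /eqP.
apply: (level_set_eq_equilibrium bE xm); rewrite -subr_le0 -d_sum big1// => i.
by move=> /di ->; rewrite subrr.
Qed.

End NotStar.

Lemma stdf_potential (v g : 'I_n -> R) x :
  (forall i, v i - \sum_j C i j * v j = g i) ->
  \sum_i v i * stdf_step C x i 0 =
  \sum_i v i * x i 0 - \sum_i g i * (x i 0 * (1 - x i 0)).
Proof.
move=> vg; under eq_bigr do rewrite stdf_stepE mulrDr mulr_sumr.
rewrite big_split /= exchange_big /= -sumrB -big_split /=.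
apply: eq_bigr => j _; rewrite -vg mulrBl mulr_suml.
rewrite [X in X + _ = _](_ : _ = \sum_l C j l * v l * (x j 0 * (1 - x j 0))).
  by ring.
by apply: eq_bigr => l _; ring.
Qed.

Let G (u w : 'cV[R]_n) := w = stdf_step C u.

Lemma stdf_lyapunov_interior :
  0 < mu -> 1 / 2 < b k 0 -> exists W, lyapunov_for c b k mu G W.
Proof.
move=> mu0 bk; have [g [gk g0 gb gc]] := dissipative_weights_exist mu0 bk.
have [v vg] := fredholm C_stoch c_dom gc.
have vk := min_principle vg g0.
have diss x (xm : level_set c mu x) := dissipation mu0 bk gk g0 gb gc xm.
exists (fun z => \sum_i v i * z i 0); split.
- apply: continuous_sumR => i; apply: continuous_mulR; first exact: continuous_cstR.
  exact: continuous_coord.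
- by move=> z [zm _]; exact: potential_gt.
- move=> y z [ym _] _ ->; rewrite (stdf_potential _ vg) lerBlDr lerDl.
  exact: (diss _ ym).1.
- move=> w y z _ [ym _] _ -> _; rewrite (stdf_potential _ vg) => e.
  by apply: (diss _ ym).2; apply: (@addrI _ (\sum_i v i * y i 0)); lra.
Qed.

Section Star.
Hypotheses (ck : c k 0 = 1 / 2) (bk : b = autocratic R k).

(** In a star, the hub receives all that the others hand over. *)
Lemma star_gain x : simplex x ->
  stdf_step C x k 0 - x k 0 = \sum_(j | j != k) x j 0 * (1 - x j 0 - x k 0).
Proof.
move=> xD; rewrite stdf_stepE (bigD1 k)//= C_diag mul0r add0r.
rewrite (eq_bigr (fun j => x j 0 * (1 - x j 0 - x k 0) + x j 0 * x k 0)) => [|j jk].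
  by rewrite big_split /= -mulr_suml (sum_others k xD.2); ring.
by rewrite (star_to_hub C_stoch C_irr c_dom C_diag ck jk); ring.
Qed.

Let star_term_ge0 x j : simplex x -> j != k -> 0 <= x j 0 * (1 - x j 0 - x k 0).
Proof.
move=> xD jk; have [l lk lj] := third_index k j n3.
have := simplex_sum3_le1 xD jk lk lj; have := xD.1 l; have := xD.1 j.
by move=> *; rewrite mulr_ge0//; lra.
Qed.

Lemma star_hub_mono x : simplex x -> x k 0 <= stdf_step C x k 0.
Proof.
by move=> xD; rewrite -subr_ge0 star_gain// sumr_ge0// => j; exact: star_term_ge0.
Qed.

(** The gain of the hub vanishes on the edges of the simplex through its vertex, so
    one step is not strict.  But a state that has a predecessor with a hub weight
    strictly between 0 and 1 has all entries positive, hence is on no edge. *)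
Lemma stdf_lyapunov_star : exists W, lyapunov_for c b k mu G W.
Proof.
exists (fun z => 0 - z k 0); split.
- by apply: continuous_subR; [exact: continuous_cstR|exact: continuous_coord].
- move=> z [[zD _] _] zb; rewrite bk autocraticE eqxx ltrD2l ltrN2.
  rewrite lt_neqAle simplex_le1// andbT; apply/eqP => zk; apply: zb.
  by rewrite bk; exact: simplex_eq_autocratic.
- by move=> y z [[yD _] _] _ ->; rewrite lerD2l lerN2; exact: star_hub_mono.
- move=> w y z [[wD _] wk] [[yD _] yk] yw -> /addrI/oppr_inj ewy /addrI/oppr_inj ezy.
  have [yk1|yk1] := eqVneq (y k 0) 1; first by rewrite bk; exact: simplex_eq_autocratic.
  have y0 j : j != k -> 0 < y j 0.
    move=> jk; rewrite yw; apply: (stdf_pos_succ wD (i := k)).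
      by rewrite wk -ewy lt_neqAle yk1 simplex_le1.
    exact: (star_from_hub_gt0 C_stoch C_irr c_dom C_diag ck jk).
  have [l lk _] := third_index k k n3; have [j jk jl] := third_index k l n3.
  have s0 : \sum_(j | j != k) y j 0 * (1 - y j 0 - y k 0) = 0.
    by rewrite -star_gain// ezy subrr.
  have t0 h : h != k -> 0 <= y h 0 * (1 - y h 0 - y k 0) by exact: star_term_ge0.
  have /eqP := psumr_eq0P t0 s0 lk.
  rewrite mulf_eq0 gt_eqF ?y0//= => /eqP.
  have h1 := simplex_sum3_le1 yD lk jk jl; have h2 := y0 _ jk => h3; exfalso; lra.
Qed.

End Star.

Lemma stdf_convergence x : simplex x -> (forall i, x <> autocratic R i) ->
  iter t (stdf_step C) x @[t --> \oo] --> b.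
Proof.
move=> xD x_naut; have x1 i : x i 0 < 1.
  rewrite lt_neqAle simplex_le1// andbT; apply/eqP => xi.
  by apply: (x_naut i); exact: simplex_eq_autocratic.
have [T xT] := stdf_interior xD x1.
have yD t : simplex (iter t (stdf_step C) x) by exact: orbit_simplex.
apply: (lyapunov_convergence n3 C_irr c_gt0 bE yD stdf_closed _ stdf_touch) => //.
- move=> mu0; set y := iter T (stdf_step C) x.
  have y0 i : 0 < y i 0 by exact: xT.
  have [m m_in ym] := interior_level_set n3 c_gt0 mu0 (yD T) y0.
  exists m => //; exists T => // t /subnK <-; elim: (t - T)%N => [|d IHd].
    by rewrite add0n.
  by apply: stdf_level IHd; case/andP: m_in => /ltW-> ->.
- move=> mu0; exists (iter T (stdf_step C) x k 0); first exact: xT.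
  have [|[_ ck bk]] := eq_star bE; first by rewrite mu0 ltxx.
  exists T => // t /subnK <-; elim: (t - T)%N => [|d IHd]; first by rewrite add0n.
  by apply: le_trans IHd _; apply: (star_hub_mono ck); exact: yD.
- move=> bk; have [mu0|[_ ck bk']] := eq_star bE.
    exact: stdf_lyapunov_interior.
  exact: stdf_lyapunov_star.
Qed.

End SingleTimescale.

(** * The original system *)

Section DeGrootFriedkin.
Context {R : realType} {n : nat}.
Variables (C : 'M[R]_n) (c : 'cV[R]_n).
Hypotheses (n3 : (3 <= n)%N) (C_stoch : row_stochastic C).
Hypotheses (C_irr : irreducible C).
Hypothesis c_dom : dominant_left C c.
Let c_gt0 := centrality_gt0 C_stoch C_irr c_dom.
Let c_sum := centrality_sum1 c_dom.
Implicit Types (u w x : 'cV[R]_n) (m : R).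

(** The total weight that the individuals, at state u, give away out of w; it is
    the factor of c in the characterization of the DF step. *)
Definition ceded u w := \sum_j (1 - u j 0) * w j 0.

Definition df_rel u w :=
  simplex w /\ forall i, (1 - u i 0) * w i 0 = ceded u w * c i 0.

Lemma influence_mul u w j :
  (w^T *m influence C u) 0 j =
  u j 0 * w j 0 + \sum_i (1 - u i 0) * w i 0 * C i j.
Proof.
rewrite mxE; under eq_bigr do rewrite influenceE mxE mulrDr.
rewrite big_split /=; congr (_ + _).
  rewrite (bigD1 j)//= eqxx mulr1n big1 ?addr0 1?mulrC// => i ij.
  by rewrite (negbTE ij) mulr0n mulr0.
by apply: eq_bigr => i _; ring.
Qed.

(** Stationarity of w for the influence matrix says that the vector of entries
    (1 - x_i) w_i is invariant under C. *)
Lemma df_step_rel x : simplex x -> df_rel x (df_step C x).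
Proof.
move=> xD; have [[wD wW] _] := df_stepP C_stoch C_irr xD.
split=> // i; set w := df_step C x in wD wW *.
pose p := \row_j ((1 - x j 0) * w j 0).
have pC : p *m C = p.
  apply/rowP => j; have /rowP/(_ j) := wW.
  rewrite influence_mul !mxE => wj; under eq_bigr do rewrite mxE.
  by move: wj; set s := \sum_i _ => wj; rewrite mulrBl mul1r -{1}wj; ring.
have /rowP/(_ i) := invariant_unique C_stoch c_dom pC.
by rewrite !mxE => ->; congr (_ * _); apply: eq_bigr => j _; rewrite mxE.
Qed.

Lemma df_simplex x : simplex x -> simplex (df_step C x).
Proof. by move=> /df_step_rel[]. Qed.

Let orbit_simplex x t : simplex x -> simplex (iter t (df_step C) x).
Proof. by move=> xD; elim: t => //= t; exact: df_simplex. Qed.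

Lemma df_closed : closed_rel df_rel.
Proof.
pose g (i : 'I_n) (p : 'cV[R]_n * 'cV[R]_n) :=
  (1 - p.1 i 0) * p.2 i 0 - ceded p.1 p.2 * c i 0.
rewrite /closed_rel (_ : mkset _ =
    [set p | simplex p.2] `&` [set p | forall i, g i p = 0]).
  have prod_cont i : continuous (fun p : 'cV[R]_n * 'cV[R]_n => (1 - p.1 i 0) * p.2 i 0).
    apply: continuous_mulR; last exact: continuous_snd_coord.
    by apply: continuous_subR; [exact: continuous_cstR|exact: continuous_fst_coord].
  apply: closedI.
    apply: (@preimage_closed _ _ snd [set z : 'cV[R]_n | simplex z]).
      by move=> p _; exact: cvg_snd.
    exact: closed_simplex.
  apply: closed_zeros => i; apply: continuous_subR => //.
  by apply: continuous_mulR; [exact: continuous_sumR|exact: continuous_cstR].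
apply/seteqP; split=> -[u w] /=; rewrite /g /=; move=> [wD uw]; split=> // i.
  by rewrite uw subrr.
by apply/eqP; rewrite -subr_eq0 uw.
Qed.

Let ceded_ge0 u w : simplex u -> simplex w -> 0 <= ceded u w.
Proof.
move=> uD wD; apply: sumr_ge0 => j _.
by rewrite mulr_ge0 ?(wD.1 j)// subr_ge0 simplex_le1.
Qed.

Lemma df_interior u w : simplex u -> (forall i, u i 0 < 1) -> df_rel u w ->
  forall i, 0 < w i 0.
Proof.
move=> uD u1 [wD uw] i.
have term_ge0 j : 0 <= (1 - u j 0) * w j 0.
  by rewrite mulr_ge0 ?(wD.1 j)// subr_ge0 ltW.
have ceded_gt0 : 0 < ceded u w.
  rewrite lt_neqAle ceded_ge0// andbT; apply/eqP => /esym s0.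
  have := wD.2; rewrite big1 => [/esym/eqP|j _]; first by rewrite oner_eq0.
  have /eqP : (1 - u j 0) * w j 0 = 0 by apply: (psumr_eq0P _ s0).
  by rewrite mulf_eq0 gt_eqF ?subr_gt0//= => /eqP.
by rewrite -(@pmulr_rgt0 _ (1 - u i 0)) ?subr_gt0// uw mulr_gt0.
Qed.

Variables (b : 'cV[R]_n) (k : 'I_n) (mu : R).
Hypothesis bE : is_equilibrium c b k mu.

Lemma df_fixed : df_step C b = b.
Proof.
have [_ unq] := df_stepP C_stoch C_irr (eq_simplex bE).
apply: unq; split; first exact: eq_simplex bE.
apply/rowP => j; rewrite influence_mul.
rewrite (eq_bigr (fun i => mu * (C i j * c i 0))) => [|i _].
  by rewrite -mulr_sumr (centrality_fix c_dom) -(eq_hump bE) mxE; ring.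
by rewrite [(1 - _) * _]mulrC (eq_hump bE); ring.
Qed.

Let df_scaled m u w i : 0 <= m <= mu -> level_set c m u -> df_rel u w ->
  u i 0 < 1 -> m * w i 0 <= ceded u w * u i 0.
Proof.
move=> m_mu um [wD uw] u1; rewrite -(@ler_pM2r _ (1 - u i 0)) ?subr_gt0//.
rewrite -mulrA [w i 0 * _]mulrC uw mulrCA -mulrA.
by apply: ler_wpM2l; [exact: (ceded_ge0 um.1 wD)|exact: (level_set_hump n3 c_gt0 bE)].
Qed.

Let level_lt1 m u i : 0 < m <= mu -> level_set c m u -> u i 0 < 1.
Proof.
move=> m_mu um; have [l li _] := third_index i i n3.
have := sum_others i um.1.2; rewrite (bigD1 l)//=.
have : 0 <= \sum_(j | (j != i) && (j != l)) u j 0.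
  by apply: sumr_ge0 => j _; exact: um.1.1.
have := um.2 l; have := profile_gt0 c_gt0 bE l m_mu; lra.
Qed.

(** From h(u_i) >= m c_i one gets m w_i <= (ceded u w) u_i, to be summed over
    i. *)
Lemma ceded_ge m u w : 0 < m <= mu -> level_set c m u -> df_rel u w ->
  m <= ceded u w.
Proof.
move=> m_in um uw; have m_mu : 0 <= m <= mu by case/andP: m_in => /ltW-> ->.
rewrite -[m]mulr1 -[ceded u w]mulr1 -{1}uw.1.2 -um.1.2 !mulr_sumr.
by apply: ler_sum => i _; apply: df_scaled => //; exact: level_lt1 um.
Qed.

(** Equality would force u to be the profile of level m, whose entries sum to less
    than 1. *)
Lemma ceded_gt m u w : 0 < m < mu -> level_set c m u -> df_rel u w ->
  m < ceded u w.
Proof.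
move=> m_in um uw; have /andP[m0 mmu] := m_in.
have m_mu : 0 <= m <= mu by rewrite !ltW.
have m_mu' : 0 < m <= mu by rewrite m0 ltW.
rewrite lt_neqAle (ceded_ge m_mu')// andbT; apply/eqP => me.
have s0 : \sum_i (ceded u w * u i 0 - m * w i 0) = 0.
  by rewrite sumrB -!mulr_sumr um.1.2 uw.1.2 me subrr.
have term_ge0 i : 0 <= ceded u w * u i 0 - m * w i 0.
  by rewrite subr_ge0 df_scaled//; exact: level_lt1 um.
have : \sum_i profile c m i < 1.
  by apply: (profile_sum_lt1 c_gt0 bE); rewrite ltW.
rewrite -um.1.2 (eq_bigr (fun i => u i 0)) ?ltxx// => i _.
apply/esym/(level_set_hump_eq n3 c_gt0 bE) => //.
have : ceded u w * u i 0 - m * w i 0 = 0 by apply: (psumr_eq0P _ s0).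
rewrite -me -mulrBr => /eqP; rewrite mulf_eq0 gt_eqF//= subr_eq0 => /eqP ui.
by rewrite [X in X * _]ui mulrC uw.2 -me.
Qed.

Let profile_lt1 m i : profile c m i < 1.
Proof. by have := @profile_le_half _ _ c m i; lra. Qed.

Let df_lower m u w i : level_set c m u -> df_rel u w ->
  ceded u w * c i 0 <= (1 - profile c m i) * w i 0.
Proof.
move=> um [wD <-]; rewrite ler_wpM2r ?(wD.1 i)//.
by rewrite lerB// um.2.
Qed.

Lemma df_level m u w :
  0 < m <= mu -> level_set c m u -> df_rel u w -> level_set c m w.
Proof.
move=> m_in um uw; have m_mu : 0 <= m <= mu by case/andP: m_in => /ltW-> ->.
split; first exact: uw.1.
move=> i; rewrite -(@ler_pM2l _ (1 - profile c m i)) ?subr_gt0//.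
apply: le_trans (df_lower i um uw); rewrite mulrC (profileK c_gt0 bE)//.
by rewrite ler_wpM2r ?(ltW (c_gt0 i))// (ceded_ge m_in).
Qed.

(** There is no contact at all: below the level mu, the DF step moves strictly
    above the barrier. *)
Lemma df_touch : touches_back C c mu df_rel.
Proof.
move=> m y z i m_in ym yz zi; have /andP[m0 mmu] := m_in; exfalso.
have m_mu : 0 <= m <= mu by rewrite !ltW.
have := df_lower i ym yz; rewrite zi [leRHS]mulrC (profileK c_gt0 bE)//.
by rewrite ler_pM2r ?c_gt0// leNgt => /negP; apply; exact: ceded_gt.
Qed.

(** With Q the sum of the c_i / (1 - u_i) over i != k, one has
    1 - w_k = (ceded u w) Q, so w_k >= u_k amounts to c_k >= u_k Q.  In terms of the
    weights, c_k - u_k Q is a sum of excesses u_i - b_i with positive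
    coefficients. *)
Lemma df_hub u w : level_set c mu u -> 0 < u k 0 -> df_rel u w ->
  u k 0 <= w k 0 /\ (w k 0 = u k 0 -> u = b).
Proof.
move=> um uk uw; have [uD up] := um; have [wD uwE] := uw.
pose a := \sum_(i | i != k) b i 0; pose B := total_weight c b k.
have d0 i := @excess_ge0 _ _ _ _ _ _ bE u i um.
have d_sum := excess_sum bE um.
have u_le i : i != k -> u i 0 <= 1 - u k 0 - a + b i 0.
  move=> ik; have := excess_le bE um ik.
  by rewrite /a (sum_others_equilibrium bE); lra.
have b_le_a i : i != k -> b i 0 <= a.
  move=> ik; rewrite /a (bigD1 i)//= lerDl sumr_ge0// => j _.
  exact: (eq_simplex bE).1.
have u1 i : i != k -> 0 < 1 - u i 0.
  by move=> ik; have := u_le i ik; have := b_le_a i ik; lra.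
pose Q := \sum_(i | i != k) c i 0 / (1 - u i 0).
have wQ : ceded u w * Q = 1 - w k 0.
  rewrite -(sum_others k wD.2) mulr_sumr; apply: eq_bigr => i ik.
  by rewrite mulrA -uwE mulrAC divff ?mul1r// gt_eqF// u1.
pose co i := B - u k 0 * weight c b i / (1 - u i 0).
have co_gt0 i : i != k -> 0 < co i.
  move=> ik; rewrite subr_gt0 ltr_pdivrMr ?u1//.
  have wB := weight_lt_total n3 c_gt0 bE ik.
  have aE : a = mu * B.
    by rewrite /a (sum_others_equilibrium bE) (others_total_weight bE).
  have bi := equilibrium_weight bE ik; have mu0 := equilibrium_level_ge0 bE.
  have w0 := weight_gt0 c_gt0 bE ik; have := u_le i ik; rewrite aE bi.
  rewrite -/B in wB *; set be := weight c b i in wB w0 *; move=> h.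
  have h1 : B * (u k 0 + mu * (B - be)) <= B * (1 - u i 0).
    by apply: ler_wpM2l; lra.
  have h2 : 0 <= B * (mu * (B - be)) by rewrite !mulr_ge0//; lra.
  nra.
have gain : c k 0 - u k 0 * Q = \sum_(i | i != k) (u i 0 - b i 0) * co i.
  have -> : \sum_(i | i != k) (u i 0 - b i 0) * co i =
      \sum_(i | i != k) (u i 0 - b i 0) * B -
      u k 0 * \sum_(i | i != k) (c i 0 / (1 - u i 0) - weight c b i).
    rewrite mulr_sumr -sumrB; apply: eq_bigr => i ik.
    rewrite -(weightK bE ik) /co; field.
    by rewrite gt_eqF// u1.
  rewrite -mulr_suml d_sum sumrB -/Q -/(total_weight c b k) -/B.
  by rewrite (hub_total_weight c_sum bE) -/B; ring.
have gain_ge0 : 0 <= c k 0 - u k 0 * Q.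
  by rewrite gain sumr_ge0// => i ik; rewrite mulr_ge0 ?d0// ltW ?co_gt0.
have ced0 := ceded_ge0 uD wD; have uwk := uwE k.
have balance : w k 0 - u k 0 = ceded u w * (c k 0 - u k 0 * Q).
  by rewrite mulrBr -uwk mulrCA wQ; ring.
split; first by rewrite -subr_ge0 balance mulr_ge0.
move=> wu; apply: (level_set_eq_equilibrium bE um).
have /eqP : ceded u w * (c k 0 - u k 0 * Q) = 0 by rewrite -balance wu subrr.
rewrite mulf_eq0 => /orP[/eqP c0|/eqP].
  move: wQ; rewrite c0 mul0r wu => h.
  by rewrite (_ : u k 0 = 1) ?simplex_le1//; [exact: eq_simplex bE|lra].
rewrite gain => s0; rewrite -subr_le0 -d_sum big1// => i ik.
have term_ge0 j : j != k -> 0 <= (u j 0 - b j 0) * co j.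
  by move=> jk; rewrite mulr_ge0 ?d0// ltW ?co_gt0.
have /eqP := psumr_eq0P term_ge0 s0 ik.
by rewrite mulf_eq0 [co i == 0]gt_eqF ?co_gt0// orbF => /eqP.
Qed.

Lemma df_convergence x : simplex x -> (forall i, x <> autocratic R i) ->
  iter t (df_step C) x @[t --> \oo] --> b.
Proof.
move=> xD x_naut; have x1 i : x i 0 < 1.
  rewrite lt_neqAle simplex_le1// andbT; apply/eqP => xi.
  by apply: (x_naut i); exact: simplex_eq_autocratic.
have yD t : simplex (iter t (df_step C) x) by exact: orbit_simplex.
have y0 := df_interior xD x1 (df_step_rel xD).
have y_rel t : df_rel (iter t (df_step C) x) (iter t.+1 (df_step C) x).
  exact: df_step_rel.
apply: (lyapunov_convergence n3 C_irr c_gt0 bE yD df_closed _ df_touch) => //.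
- move=> mu0; have [m m_in ym] := interior_level_set n3 c_gt0 mu0 (yD 1%N) y0.
  exists m => //; exists 1%N => // t /subnK <-; elim: (t - 1)%N => [//|d IHd].
  exact: df_level IHd (y_rel _).
- move=> mu0; exists (df_step C x k 0); first exact: y0.
  exists 1%N => // t /subnK <-.
  have : forall d, df_step C x k 0 <= iter (d + 1) (df_step C) x k 0.
    elim=> [//|d IHd]; apply: (le_trans IHd); apply: (df_hub _ _ (y_rel _)).1.
      split=> // i; rewrite /profile mu0 mul0r kappa0; exact: (yD _).1.
    by apply: lt_le_trans IHd; exact: y0.
  exact.
- move=> bk; exists (fun z => 0 - z k 0); split.
  + by apply: continuous_subR; [exact: continuous_cstR|exact: continuous_coord].
  + move=> z [zm _] zb; rewrite ltrD2l ltrN2 ltNge; apply/negP => bz; apply: zb.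
    exact: (level_set_eq_equilibrium bE).
  + by move=> y z [ym yk] _ yz; rewrite lerD2l lerN2; exact: (df_hub ym yk yz).1.
  + move=> w y z _ [ym yk] _ yz _ /addrI/oppr_inj; exact: (df_hub ym yk yz).2.
Qed.

End DeGrootFriedkin.

(** * Ranking of the individuals, and the theorem *)

(** Outside the star case any two entries of b sum to less than 1, and
    mu (c_j - c_i) = (b_j - b_i) (1 - b_i - b_j), so that b and c are ordered alike;
    moreover b_i / c_i = mu / (1 - b_i). *)
Lemma favours_central_equilibrium (R : realType) (n : nat) (c b : 'cV[R]_n)
    (k : 'I_n) (mu : R) :
  (3 <= n)%N -> (forall i, 0 < c i 0) -> \sum_i c i 0 = 1 ->
  is_equilibrium c b k mu -> favours_central c b.
Proof.
move=> n3 c_gt0 c_sum bE; have [mu0|[_ ck bk]] := eq_star bE; last first.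
  left; exists k; split=> // i ik.
  have cD : simplex c by split=> // j; exact: ltW.
  have [l lk li] := third_index k i n3.
  by have := simplex_sum3_le1 cD ik lk li; have := c_gt0 l; lra.
right.
have diff i j : mu * (c j 0 - c i 0) = (b j 0 - b i 0) * (1 - b i 0 - b j 0).
  by rewrite mulrBr -!(eq_hump bE); ring.
have mono i j : (b i 0 <= b j 0) = (c i 0 <= c j 0).
  have [->|ij] := eqVneq i j; first by rewrite !lexx.
  have pair := equilibrium_pair n3 c_gt0 bE mu0 ij.
  rewrite -subr_ge0 -(@pmulr_lge0 _ (1 - b i 0 - b j 0)); last by lra.
  by rewrite -diff pmulr_rge0// subr_ge0.
split=> // i j cij.
have bij : b i 0 < b j 0 by rewrite ltNge mono -ltNge.
have b1 l : 0 < 1 - b l 0.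
  have [h hl _] := third_index l l n3; have := equilibrium_pair n3 c_gt0 bE mu0 hl.
  by have := equilibrium_gt0 c_gt0 bE h mu0; lra.
have ratio l : b l 0 / c l 0 = mu / (1 - b l 0).
  have cl : c l 0 != 0 by rewrite gt_eqF.
  have bl : 1 - b l 0 != 0 by rewrite gt_eqF.
  by apply/eqP; rewrite eqr_div// (eq_hump bE).
by rewrite !ratio ltr_pM2l// ltf_pV2 ?posrE//; lra.
Qed.

Theorem mainTheorem3 (R : realType) (n : nat) (hn : (3 <= n)%N)
  (C : 'M[R]_n) (C_stoch : row_stochastic C) (C_irr : irreducible C)
  (C_diag : forall i, C i i = 0)
  (c : 'cV[R]_n) (c_dom : dominant_left C c)
  (x0 : 'cV[R]_n) (x0_simplex : simplex x0)
  (x0_nonaut : forall i, x0 <> autocratic R i) :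
  exists xeq : 'cV[R]_n,
    [/\ simplex xeq,
        stdf_step C xeq = xeq /\ df_step C xeq = xeq,
        iter t (stdf_step C) x0 @[t --> \oo] --> xeq,
        iter s (df_step C) x0 @[s --> \oo] --> xeq
      & favours_central c xeq].
Proof.
have c_gt0 := centrality_gt0 C_stoch C_irr c_dom.
have c_sum := centrality_sum1 c_dom.
have c_half := centrality_le_half C_stoch C_irr c_dom C_diag.
have n0 : (0 < n)%N by exact: leq_trans hn.
have [k [b [mu bE]]] := equilibrium_exists n0 c_gt0 c_half c_sum.
exists b; split.
- exact: eq_simplex bE.
- by split; [exact: (stdf_fixed c_dom bE)|exact: (df_fixed C_stoch C_irr c_dom bE)].
- exact: (stdf_convergence hn C_stoch C_irr C_diag c_dom bE x0_simplex x0_nonaut).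
- exact: (df_convergence hn C_stoch C_irr c_dom bE x0_simplex x0_nonaut).
- exact: (favours_central_equilibrium hn c_gt0 c_sum bE).
Qed.
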